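(* Let $\omega$ be a non-quasianalytic subadditive weight function, let $m>0$ be an integer, and consider the differential operator with polynomial coefficients $$A(x,D)=\sum_{|\alpha+\beta|\le m}c_{\alpha\beta}x^\alpha D_x^\beta,\qquad c_{\alpha\beta}\in\mathbb{C},$$ where $\alpha,\beta\in\mathbb{N}_0^d$. Then for every $u\in\mathcal{S}'_\omega(\mathbb{R}^d)$ we have $$\mathrm{WF}'_\omega(A(x,D)u)\subseteq\mathrm{WF}'_\omega(u).$$
   Context: A non-quasianalytic subadditive weight function is a continuous increasing $\omega:[0,+\infty)\to[0,+\infty)$ with: $(\alpha)$ $\omega(t_1+t_2)\le\omega(t_1)+\omega(t_2)$ for all $t_1,t_2\ge0$; $(\beta)$ $\int_1^{+\infty}\omega(t)t^{-2}dt<+\infty$; $(\gamma)$ $\log t=o(\omega(t))$ as $t\to+\infty$; $(\delta)$ $t\mapsto\omega(e^t)$ is convex. For vectors $\zeta$, $\omega(\zeta):=\omega(|\zeta|)$. Fourier transform: $\hat f(\xi)=\int_{\mathbb{R}^d}e^{-i\langle x,\xi\rangle}f(x)dx$. $\mathcal{S}_\omega(\mathbb{R}^d)$ is the set of Schwartz functions $u$ such that for all $\lambda>0$ and all multi-indices $\alpha$, $\sup_x e^{\lambda\omega(x)}|D^\alpha u(x)|<\infty$ and $\sup_\xi e^{\lambda\omega(\xi)}|D^\alpha\hat u(\xi)|<\infty$, with $D^\alpha=(-i)^{|\alpha|}\partial^\alpha$; it is a Fréchet space with these seminorms, and $\mathcal{S}'_\omega(\mathbb{R}^d)$ is its dual.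 The bracket $\langle u,\psi\rangle$ for $u\in\mathcal{S}'_\omega$, $\psi\in\mathcal{S}_\omega$ is conjugate linear in $\psi$ and consistent with $\langle f,g\rangle=\int f\bar g$. For $u\in\mathcal{S}'_\omega$: $\langle x^\alpha u,\psi\rangle=\langle u,x^\alpha\psi\rangle$ and $\langle D^\beta u,\psi\rangle=\langle u,D^\beta\psi\rangle$. For $z=(x,\xi)\in\mathbb{R}^{2d}$, $\Pi(z)f(y)=e^{i\langle y,\xi\rangle}f(y-x)$. For a window $\varphi\in\mathcal{S}_\omega(\mathbb{R}^d)\setminus\{0\}$ and $f\in\mathcal{S}'_\omega(\mathbb{R}^d)$, the short-time Fourier transform is $V_\varphi f(z)=\langle f,\Pi(z)\varphi\rangle$. $\mathrm{WF}'_\omega(u)$: given a window $\varphi\in\mathcal{S}_\omega(\mathbb{R}^d)\setminus\{0\}$, a point $z_0\in\mathbb{R}^{2d}\setminus\{0\}$ is not in $\mathrm{WF}'_\omega(u)$ if there is an open conic set $\Gamma\subseteq\mathbb{R}^{2d}\setminus\{0\}$ containing $z_0$ with $\sup_{z\in\Gamma}e^{\lambda\omega(z)}|V_\varphi u(z)|<+\infty$ for all $\lambda>0$. (This set does not depend on the choice of $\varphi$.) *)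

(* Defs.v *)
From HB Require Import structures.
From mathcomp Require Import all_boot all_order all_algebra.
From mathcomp Require Import all_classical all_reals all_analysis.
From mathcomp Require Import complex.

Set Implicit Arguments.
Unset Strict Implicit.
Unset Printing Implicit Defensive.

Import Order.TTheory GRing.Theory Num.Theory.
Import numFieldNormedType.Exports.

Local Open Scope classical_set_scope.
Local Open Scope ring_scope.
Local Open Scope complex_scope.

(* Lebesgue measure on R^n, as the n-fold product of the Lebesgue measure of R
   on the product sigma-algebra of n.-tuple R; R^0 carries the unit mass. *)
Section LebesgueRn.
Variable R : realType.

Local Notation T := (measurableTypeR R).

Definition tcons n (p : T * n.-tuple T) : n.+1.-tuple T := [tuple of p.1 :: p.2].

Lemma measurable_tcons n : measurable_fun setT (@tcons n).
Proof. exact: measurable_cons. Qed.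

Section step.
Variables (n : nat) (mu : {sigma_finite_measure set (n.-tuple T) -> \bar R}).

Definition step_measure : set (n.+1.-tuple T) -> \bar R :=
  pushforward (@lebesgue_measure R \x mu)%E (@tcons n).

Let step_measure0 : step_measure set0 = 0%E.
Proof. by rewrite /step_measure /pushforward preimage_set0 measure0. Qed.

Let step_measure_ge0 A : (0 <= step_measure A)%E.
Proof. by have mf := @measurable_tcons n; exact: measure_ge0. Qed.

Let step_measure_sigma_additive : semi_sigma_additive step_measure.
Proof.
by have mf := @measurable_tcons n; exact: measure_semi_sigma_additive.
Qed.

HB.instance Definition _ := isMeasure.Build _ _ _ step_measure
  step_measure0 step_measure_ge0 step_measure_sigma_additive.

Let step_measure_sigma_finite : sigma_finite setT step_measure.
Proof.
have /sigma_finiteP[A [TA ndA Aoo]] := sigma_finiteT (@lebesgue_measure R).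
have /sigma_finiteP[B [TB ndB Boo]] := sigma_finiteT mu.
pose g (t : n.+1.-tuple T) : T * n.-tuple T := (thead t, [tuple of behead t]).
have mg : measurable_fun setT g.
  by apply/measurable_fun_pairP; split;
    [exact: measurable_tnth|exact: measurable_behead].
have gK p : g (tcons p) = p.
  by case: p => x t; congr pair; apply: val_inj.
exists (fun k => g @^-1` (A k `*` B k)).
  rewrite -preimage_bigcup -(preimage_setT g) -setXTT TA TB.
  congr (_ @^-1` _); apply/seteqP; split=> -[x y] /=.
    move=> [[i _ Aix] [j _ Bjy]]; exists (maxn i j) => //; split.
    - by move: x Aix; exact/subsetPset/ndA/leq_maxl.
    - by move: y Bjy; exact/subsetPset/ndB/leq_maxr.
  by move=> [i _ [Aix Biy]]; split; exists i.
move=> k; have [mA Ak] := Aoo k; have [mB Bk] := Boo k; split.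
  by rewrite -[X in measurable X]setTI; apply: mg => //; exact: measurableX.
rewrite /step_measure /pushforward.
have -> : @tcons n @^-1` (g @^-1` (A k `*` B k)) = A k `*` B k.
  by apply/funext => p; rewrite /preimage /mkset gK.
by rewrite product_measure1E// lte_mul_pinfty// ge0_fin_numE.
Qed.

HB.instance Definition _ := Measure_isSigmaFinite.Build _ _ _ step_measure
  step_measure_sigma_finite.

End step.

Fixpoint lebesgue_tuple n : {sigma_finite_measure set (n.-tuple T) -> \bar R} :=
  match n with
  | 0 => dirac [tuple]
  | n'.+1 => step_measure (lebesgue_tuple n')
  end.

End LebesgueRn.

Record weight (R : realType) (w : R -> R) : Prop := Weight {
  weight_cont : {within `[0, +oo[, continuous w};
  weight_ge0 : forall t : R, 0 <= t -> 0 <= w t;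
  weight_homo : forall s t : R, 0 <= s -> s <= t -> w s <= w t;
  weight_subadd : forall s t : R, 0 <= s -> 0 <= t -> w (s + t) <= w s + w t;
  weight_nonquasianalytic :
    (\int[lebesgue_measure]_(t in `[1%R, +oo[) (w t / t ^+ 2)%:E < +oo)%E;
  (* ln t = o(w t): the little-o notation of the library has no filter
     instance at +oo. *)
  weight_ln : forall e : R, 0 < e ->
    \forall t \near +oo, `|ln t| <= e * `|w t|;
  weight_convex :
    @convex_function R R^o [set: R^o] (fun t : R^o => w (expR t) : R^o)
}.

Section EuclideanSpace.
Variables (R : realType) (d : nat).
Implicit Types (x y : 'rV[R]_d) (f : 'rV[R]_d -> R[i]).

Definition dotv x y : R := \sum_i x ord0 i * y ord0 i.

(* The library norm of 'rV[R]_d is the sup norm. *)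
Definition enorm x : R := Num.sqrt (dotv x x).

Definition cmod (z : R[i]) : R := ComplexField.Normc.normc z.

Definition cis (t : R) : R[i] := cos t +i* sin t.

Definition multi_index := {ffun 'I_d -> nat}.

Definition mlength (a : multi_index) : nat := \sum_i a i.

Definition mono (a : multi_index) x : R[i] := (\prod_i x ord0 i ^+ a i)%:C.

Definition partial (j : 'I_d) f : 'rV[R]_d -> R[i] := fun x =>
  'D_(delta_mx ord0 j) (fun y => complex.Re (f y)) x +i*
  'D_(delta_mx ord0 j) (fun y => complex.Im (f y)) x.

Definition partials (s : seq 'I_d) f := foldr partial f s.

(* C^oo: every iterated partial derivative is (Frechet) differentiable. *)
Definition smooth f := forall (s : seq 'I_d) x,
  differentiable (fun y => complex.Re (partials s f y)) x /\
  differentiable (fun y => complex.Im (partials s f y)) x.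

Definition Dop (a : multi_index) f : 'rV[R]_d -> R[i] := fun x =>
  (0 -i* 1) ^+ mlength a *
  partials (flatten [seq nseq (a j) j | j <- enum 'I_d]) f x.

Definition integral_rV (f : 'rV[R]_d -> R) : R :=
  \int[lebesgue_tuple R d]_t f (\row_j tnth t j).

Definition cintegral f : R[i] :=
  integral_rV (fun x => complex.Re (f x)) +i*
  integral_rV (fun x => complex.Im (f x)).

Definition fourier f : 'rV[R]_d -> R[i] := fun xi =>
  cintegral (fun x => cis (- dotv x xi) * f x).

Definition schwartz f := smooth f /\
  forall a b : multi_index, has_ubound (range (fun x => cmod (mono a x * Dop b f x))).

Section Weighted.
Variable w : R -> R.

Definition growth (l : R) x : R := expR (l * w (enorm x)).

(* The sets whose suprema are the seminorms of S_w. *)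
Definition direct_vals (l : R) (a : multi_index) f : set R :=
  range (fun x => growth l x * cmod (Dop a f x)).
Definition fourier_vals (l : R) (a : multi_index) f : set R :=
  range (fun xi => growth l xi * cmod (Dop a (fourier f) xi)).

Definition Sw : set ('rV[R]_d -> R[i]) := [set f | schwartz f /\
  forall (l : R) (a : multi_index), 0 < l ->
    has_ubound (direct_vals l a f) /\ has_ubound (fourier_vals l a f)].

(* An element u of S'_w is represented by psi |-> <u, psi>, which is conjugate
   linear on S_w and continuous for the topology of the seminorms; its values
   outside S_w are irrelevant. *)
Definition conj_linear (u : ('rV[R]_d -> R[i]) -> R[i]) :=
  forall (c : R[i]) f g, Sw f -> Sw g ->
    u (fun x => c * f x + g x) = conjc c * u f + u g.

Definition seminorm_continuous (u : ('rV[R]_d -> R[i]) -> R[i]) :=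
  forall f, Sw f -> forall e : R, 0 < e ->
  exists (J : seq (R * multi_index)) (r : R),
    [/\ forall j, j \in J -> 0 < j.1, 0 < r &
     forall g, Sw g ->
       (forall j, j \in J ->
          sup (direct_vals j.1 j.2 (fun x => g x - f x)) < r /\
          sup (fourier_vals j.1 j.2 (fun x => g x - f x)) < r) ->
       cmod (u g - u f) < e].

Definition Sw_dual (u : ('rV[R]_d -> R[i]) -> R[i]) :=
  conj_linear u /\ seminorm_continuous u.

End Weighted.

Implicit Type u : ('rV[R]_d -> R[i]) -> R[i].

Definition dual_mono (a : multi_index) u : ('rV[R]_d -> R[i]) -> R[i] :=
  fun f => u (fun x => mono a x * f x).

Definition dual_Dop (a : multi_index) u : ('rV[R]_d -> R[i]) -> R[i] :=
  fun f => u (Dop a f).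

Definition of_bounded m (a : {ffun 'I_d -> 'I_m.+1}) : multi_index :=
  [ffun i => nat_of_ord (a i)].

(* Multi-indices with |a + b| <= m have all their entries at most m, hence the
   finite index types. *)
Definition diffop m (c : multi_index -> multi_index -> R[i]) u :
    ('rV[R]_d -> R[i]) -> R[i] := fun f =>
  \sum_(a : {ffun 'I_d -> 'I_m.+1})
    \sum_(b : {ffun 'I_d -> 'I_m.+1} |
        (mlength (of_bounded a) + mlength (of_bounded b) <= m)%N)
      c (of_bounded a) (of_bounded b) *
      dual_mono (of_bounded a) (dual_Dop (of_bounded b) u) f.

(* z = (x, xi) in R^(2d) is row_mx x xi. *)
Definition tfshift (z : 'rV[R]_(d + d)) f : 'rV[R]_d -> R[i] := fun y =>
  cis (dotv y (rsubmx z)) * f (y - lsubmx z).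

Definition stft (phi : 'rV[R]_d -> R[i]) u : 'rV[R]_(d + d) -> R[i] := fun z =>
  u (tfshift z phi).

End EuclideanSpace.

Definition conic (R : realType) n (G : set 'rV[R]_n) :=
  forall (t : R) z, 0 < t -> G z -> G (t *: z).

Definition gabor_wf (R : realType) (d : nat) (w : R -> R)
    (phi : 'rV[R]_d -> R[i]) (u : ('rV[R]_d -> R[i]) -> R[i]) :
    set 'rV[R]_(d + d) :=
  [set z0 | z0 != 0 /\
    ~ exists G : set 'rV[R]_(d + d),
        [/\ open G, conic G, ~ G 0, G z0 &
         forall l : R, 0 < l ->
           has_ubound [set growth w l z * cmod (stft phi u z) | z in G]]].

(* Main.v *)
(* Write X for one of the operators x_j, D_j, and let U_h be the one-parameter
   group it generates (modulations, resp. translations).  For g in S_w the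
   remainder U_h g - g - h X' g (X' = i x_j or d_j) is O(h^2) in every seminorm;
   on the Fourier side a modulation remainder becomes a translation remainder
   and conversely, so both families of seminorms are handled by the same two
   estimates.  Applied to g = Pi(z) phi, where U_h Pi(z) phi is a unimodular
   multiple of Pi(z') phi with |z' - z| = h, this gives

     h |u(X Pi(z) phi)| <= |V u(z')| + |V u(z)| + C h^2 exp(M w(z)).

   If V u decays faster than every exp(- l w) on a cone, the choice
   h = exp(- k w(z)) with k large shows that V(X u) does so on any narrower cone,
   with the same window.  Iterating over the factors of x^a D^b and adding up
   finitely many terms yields the theorem; no inversion formula is needed. *)
From HB Require Import structures.
Require Import Defs.
From mathcomp Require Import all_boot all_order all_algebra.
From mathcomp Require Import all_classical all_reals all_analysis.
From mathcomp Require Import complex measurable_realfun ring lra.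

Set Implicit Arguments.
Unset Strict Implicit.
Unset Printing Implicit Defensive.

Import Order.TTheory GRing.Theory Num.Theory.
Import numFieldNormedType.Exports.

Local Open Scope classical_set_scope.
Local Open Scope ring_scope.
Local Open Scope complex_scope.

(** * Symmetry of second derivatives *)

(** One obstacle is [Dop], which differentiates only along words sorted by axis, while the product
    rule and the remainders produce arbitrary words; hence the symmetry of second derivatives and
    the bounds [bnd] over all words of bounded length. Another is that the seminorms also see the
    Fourier transform, so the transforms of [x_j f], of [d_j f] and of both remainders have to be
    computed. Differentiation under the integral and integration by parts are avoided: a Taylor
    remainder of a transform is the transform of a quadratically small function. Integrals are
    dominated by products of Cauchy densities, which a fixed power of exp w controls because ln t =
    o(w(t)).

    After division by [h] the error in the quotient estimate is [h] exp(M w) with [M] fixed, while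
    [V u] decays at arbitrary rate; so [h] may be any negative power of exp w. Points at distance at
    most 1 are sure to stay in the wider cone only far from the origin; near the origin an a priori
    growth bound on [V u] suffices. *)

Section RealCalculus.
Variables (R : realType) (V : normedModType R).
Implicit Types (f g : V -> R) (x v : V).

Lemma is_derive_line f x v (t : R) : differentiable f (x + t *: v) ->
  is_derive t 1 (fun s : R => f (x + s *: v)) ('D_v f (x + t *: v)).
Proof.
move=> df.
have E : (fun h : R => h^-1 *: (f (x + (h *: 1 + t) *: v) - f (x + t *: v))) =
         (fun h : R => h^-1 *: (f (h *: v + (x + t *: v)) - f (x + t *: v))).
  apply/funext => h; congr (_ *: (f _ - _)).
  by rewrite [h *: 1]mulr1 scalerDl addrCA.
have dv : derivable f (x + t *: v) v by exact: diff_derivable.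
split; first by move: dv; rewrite /derivable /= E.
by rewrite /derive /= E.
Qed.

(** The intermediate point is located only by |t| <= |h|, a form that serves both signs of [h]. *)
Lemma line_MVT f x v (h : R) : (forall y, differentiable f y) ->
  exists2 t, `|t| <= `|h| & f (x + h *: v) - f x = h * 'D_v f (x + t *: v).
Proof.
move=> df.
pose g (t : R) := f (x + t *: v); pose g' (t : R) := 'D_v f (x + t *: v).
have dg (t : R) : is_derive t 1 g (g' t) by exact: is_derive_line.
have cg A : {within A, continuous g}.
  apply: continuous_subspaceT => t; apply: differentiable_continuous.
  by apply/derivable1_diffP; exact: (@ex_derive _ _ _ _ _ _ _ (dg t)).
have g0 : g 0 = f x by rewrite /g scale0r addr0.
have [h0|h0] := leP 0 h.
  have [t] := MVT_segment h0 (fun t _ => dg t) (@cg _).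
  rewrite in_itv /= subr0 g0 => /andP[t0 th] E.
  by exists t; [rewrite !ger0_norm|rewrite mulrC -E].
have [t] := MVT_segment (ltW h0) (fun t _ => dg t) (@cg _).
rewrite in_itv /= sub0r g0 => /andP[ht t0] E.
exists t; first by rewrite (ler0_norm t0) (ler0_norm (ltW h0)) lerN2.
by rewrite -[LHS]opprB E /g' mulrN opprK mulrC.
Qed.

Lemma derive_translate f a x v :
  'D_v (fun y => f (y + a)) x = 'D_v f (x + a).
Proof.
have E : (fun h : R => h^-1 *: (f (h *: v + x + a) - f (x + a))) =
         (fun h : R => h^-1 *: (f (h *: v + (x + a)) - f (x + a))).
  by apply/funext => h; rewrite addrA.
by rewrite /derive /= E.
Qed.

(** The mean value theorem is applied to [f], then to its derivative at the intermediate point; this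
    loses the factor 1/2 of Taylor's formula. *)
Lemma line_taylor2 f x v (h B : R) : (forall y, differentiable f y) ->
  (forall y, differentiable ('D_v f) y) ->
  (forall t : R, `|t| <= `|h| -> `|'D_v ('D_v f) (x + t *: v)| <= B) ->
  `|f (x + h *: v) - f x - h * 'D_v f x| <= h ^+ 2 * B.
Proof.
move=> df d2f hB; have [t th ->] := line_MVT x v h df.
rewrite -mulrBr; have [s st ->] := line_MVT x v t d2f.
rewrite !normrM mulrA; have /hB D2 := le_trans st th.
rewrite -[h ^+ 2]ger0_norm ?sqr_ge0 // normrX expr2.
by apply: ler_pM; rewrite ?mulr_ge0 ?ler_wpM2l.
Qed.

(** The limit step in the symmetry of mixed derivatives: the points where the two values agree tend
    to [x] with [h], and both functions are continuous there. *)
Lemma eq_of_shared_values (F G : V -> R) x v w :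
  {for x, continuous F} -> {for x, continuous G} ->
  (forall h : R, h != 0 -> exists s t s' t' : R,
    [/\ `|s| <= `|h|, `|t| <= `|h|, `|s'| <= `|h|, `|t'| <= `|h| &
      F (x + s *: v + t *: w) = G (x + s' *: w + t' *: v)]) ->
  F x = G x.
Proof.
have cont (g : V -> R) a b (e : R) : 0 < e -> {for x, continuous g} ->
    exists2 r : R, 0 < r & forall h s t : R, `|h| < r -> `|s| <= `|h| ->
      `|t| <= `|h| -> `|g x - g (x + s *: a + t *: b)| < e.
  move=> e0 cg.
  have /cvgrPdist_lt/(_ _ e0)/nbhs_ballP[r /= r0 rg] := cg.
  pose K := `|a| + `|b| + 1; have K0 : 0 < K by rewrite ltr_wpDl.
  exists (r / K); first by rewrite divr_gt0.
  move=> h s t; rewrite ltr_pdivlMr // => hr sh th.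
  apply: rg; rewrite -ball_normE /ball_ /= -addrA opprD addNKr normrN.
  apply: (le_lt_trans (ler_normD _ _)); rewrite !normrZ.
  apply: le_lt_trans hr; rewrite /K !mulrDr mulr1.
  by rewrite ler_wpDr // lerD // ler_wpM2r.
move=> cF cG FG.
apply/eqP; rewrite -subr_eq0 -normr_le0; apply/ler_addgt0Pr => /= e e0.
rewrite add0r.
have e2 : 0 < e / 2 by rewrite divr_gt0.
have [r1 r10 H1] := cont _ v w _ e2 cF.
have [r2 r20 H2] := cont _ w v _ e2 cG.
pose h := Num.min r1 r2 / 2.
have m0 : 0 < Num.min r1 r2 by rewrite lt_min r10.
have h0 : 0 < h by rewrite divr_gt0.
have : `|h| < Num.min r1 r2.
  by rewrite gtr0_norm // ltr_pdivrMr // ltr_pMr // ltr1n.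
rewrite lt_min => /andP[hr1 hr2].
have [s [t [s' [t' [sh th sh' th' E]]]]] := FG h (lt0r_neq0 h0).
have := H2 _ _ _ hr2 sh' th'; rewrite -E distrC => A2.
have A1 := H1 _ _ _ hr1 sh th.
rewrite -(subrKA (F (x + s *: v + t *: w))).
apply: (le_trans (ler_normD _ _)).
by rewrite [e]splitr lerD // ltW.
Qed.

(* Two applications of the mean value theorem to the second difference. *)
Lemma derive_comm f v w x : (forall y, differentiable f y) ->
  (forall y, differentiable ('D_v f) y) ->
  (forall y, differentiable ('D_w f) y) ->
  {for x, continuous ('D_w ('D_v f))} ->
  {for x, continuous ('D_v ('D_w f))} ->
  'D_w ('D_v f) x = 'D_v ('D_w f) x.
Proof.
move=> df dvf dwf cwv cvw; apply: (@eq_of_shared_values _ _ x v w cwv cvw).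
have key a b : (forall y, differentiable ('D_a f) y) -> forall h : R, h != 0 ->
    exists s t : R, [/\ `|s| <= `|h|, `|t| <= `|h| &
      h * h * 'D_b ('D_a f) (x + s *: a + t *: b) =
      f (x + h *: a + h *: b) - f (x + h *: a) - f (x + h *: b) + f x].
  move=> daf h h0; pose g y := f (y + h *: b) - f y.
  have dft y : differentiable (fun y => f (y + h *: b)) y.
    by apply: (@differentiable_comp _ _ _ _ (fun z => z + h *: b) f).
  have dg y : differentiable g y by exact: differentiableB.
  have [s sh Es] := line_MVT x a h dg.
  have gE : 'D_a g (x + s *: a) =
      'D_a f (x + s *: a + h *: b) - 'D_a f (x + s *: a).
    rewrite /g deriveB; [|exact: diff_derivable..].
    by rewrite derive_translate.
  have [t th Et] := line_MVT (x + s *: a) b h daf.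
  exists s, t; split => //; rewrite -mulrA -Et -gE -Es /g.
  by ring.
move=> h h0; have [s [t [sh th E1]]] := key v w dvf h h0.
have [s' [t' [sh' th' E2]]] := key w v dwf h h0.
exists s, t, s', t'; split; [exact: sh|exact: th|exact: sh'|exact: th'|].
apply: (mulfI (mulf_neq0 h0 h0)).
apply: etrans E1 (etrans _ (esym E2)).
(* The second difference is symmetric in [v] and [w]. *)
by rewrite [x + h *: w + _]addrAC; ring.
Qed.

End RealCalculus.

(** * Complex moduli and Taylor bounds on the unit circle *)

Section ComplexModulus.
Variable R : realType.
Implicit Types (x y : R[i]) (s t : R).

Lemma cmodM x y : cmod (x * y) = cmod x * cmod y.
Proof. exact: ComplexField.Normc.normcM. Qed.

Lemma cmodD x y : cmod (x + y) <= cmod x + cmod y.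
Proof. exact: le_normcD. Qed.

Lemma cmodN x : cmod (- x) = cmod x.
Proof. exact: normcN. Qed.

Lemma cmod_ge0 x : 0 <= cmod x.
Proof. by case: x => a b; exact: sqrtr_ge0. Qed.

Lemma cmodB x y : cmod (x - y) <= cmod x + cmod y.
Proof. by rewrite -[cmod y]cmodN; exact: cmodD. Qed.

Lemma cmod_real t : cmod t%:C = `|t|.
Proof. by rewrite /cmod /= expr0n /= addr0 sqrtr_sqr. Qed.

Lemma cmod0 : cmod (0 : R[i]) = 0.
Proof. exact: ComplexField.Normc.normc0. Qed.

Lemma cmod_i : cmod ('i : R[i]) = 1.
Proof. by rewrite /cmod /= expr0n expr1n add0r sqrtr1. Qed.

Lemma cmod_conjc x : cmod (conjc x) = cmod x.
Proof. by case: x => a b; rewrite /cmod /= sqrrN. Qed.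

Lemma cmodX x n : cmod (x ^+ n) = cmod x ^+ n.
Proof.
elim: n => [|n IH]; first exact: ComplexField.Normc.normc1.
by rewrite !exprS cmodM IH.
Qed.

Lemma cmod_le_ReIm x : cmod x <= `|complex.Re x| + `|complex.Im x|.
Proof.
case: x => a b; have -> : a +i* b = a%:C + 'i * b%:C by simpc.
by rewrite (le_trans (cmodD _ _)) // cmodM cmod_i mul1r !cmod_real /=; simpc.
Qed.

Lemma Re_le_cmod x : `|complex.Re x| <= cmod x.
Proof.
case: x => a b /=; rewrite -sqrtr_sqr ler_wsqrtr //.
by rewrite lerDl sqr_ge0.
Qed.

Lemma Im_le_cmod x : `|complex.Im x| <= cmod x.
Proof.
case: x => a b /=; rewrite -sqrtr_sqr ler_wsqrtr //.
by rewrite lerDr sqr_ge0.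
Qed.

Lemma cmod_cis t : cmod (cis t) = 1.
Proof. by rewrite /cmod /= cos2Dsin2 sqrtr1. Qed.

Lemma cisD s t : cis (s + t) = cis s * cis t :> R[i].
Proof.
rewrite /cis cosD sinD; simpc; congr (_ +i* _).
by rewrite [sin s * _]mulrC; ring.
Qed.

Let differentiable_cos (y : R) : differentiable (@cos R) y.
Proof. exact/derivable1_diffP. Qed.

Let differentiable_sin (y : R) : differentiable (@sin R) y.
Proof. exact/derivable1_diffP. Qed.

Let D_cos (y : R) : 'D_1 (@cos R) y = - sin y.
Proof. by rewrite derive_val. Qed.

Let D_sin (y : R) : 'D_1 (@sin R) y = cos y.
Proof. by rewrite derive_val. Qed.

Let D_cosE : 'D_1 (@cos R) = fun y : R => - sin y.
Proof. exact/funext. Qed.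

Let D_sinE : 'D_1 (@sin R) = @cos R.
Proof. exact/funext. Qed.

Let cos_le1 (t : R) : `|cos t| <= 1.
Proof. by rewrite ler_norml cos_geN1 cos_le1. Qed.

Let sin_le1 (t : R) : `|sin t| <= 1.
Proof. by rewrite ler_norml sin_geN1 sin_le1. Qed.

(** The factor 2, here and in [cis_taylor2], comes from bounding real and imaginary parts
    separately. *)
Lemma cis_taylor1 t : cmod (cis t - 1) <= 2 * `|t|.
Proof.
apply: (le_trans (cmod_le_ReIm _)); rewrite /= subr0.
have [a _] := @line_MVT R R _ (0 : R) (1 : R) t differentiable_cos.
have [b _] := @line_MVT R R _ (0 : R) (1 : R) t differentiable_sin.
rewrite !D_cos !D_sin cos0 sin0 subr0 add0r -[t *: 1]/(t * 1) mulr1 => -> ->.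
rewrite !normrM normrN -mulrDr mulrC ler_wpM2r //.
by rewrite -[leRHS]/(1 + 1) lerD.
Qed.

Lemma cis_taylor2 t : cmod (cis t - 1 - 'i * t%:C) <= 2 * t ^+ 2.
Proof.
apply: (le_trans (cmod_le_ReIm _)); rewrite /=; simpc.
have D1 (y : R) : differentiable ('D_1 (@cos R)) y.
  by rewrite D_cosE; exact: (differentiableN (differentiable_sin y)).
have D2 (y : R) : differentiable ('D_1 (@sin R)) y by rewrite D_sinE.
have H1 := @line_taylor2 R R _ (0 : R) (1 : R) t 1 differentiable_cos D1.
have H2 := @line_taylor2 R R _ (0 : R) (1 : R) t 1 differentiable_sin D2.
move: H1 H2; rewrite D_sinE D_cosE !D_sin !D_cos !cos0.
rewrite !sin0 !add0r oppr0 mulr0 !subr0 !addr0 !mulr1.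
rewrite -[t *: 1]/(t * 1) mulr1 => H1 H2.
rewrite mulr_natl [leRHS]mulr2n lerD //.
  by apply: H1 => s _; rewrite deriveN // D_sin normrN.
by apply: H2 => s _; rewrite D_cos normrN.
Qed.

End ComplexModulus.

(** * Iterated partial derivatives of complex-valued functions *)

Section SmoothFunctions.
Variables (R : realType) (d : nat).
Local Notation V := 'rV[R]_d.
Local Notation C := R[i].
Implicit Types (f g : V -> C) (x y v xi : V) (s : seq 'I_d) (j k : 'I_d).

Local Notation e_ j := (delta_mx ord0 j : V).

Definition cdiff f x := differentiable (fun y => complex.Re (f y)) x /\
  differentiable (fun y => complex.Im (f y)) x.

Lemma cdiff_cst (c : C) x : cdiff (fun=> c) x.
Proof. by split; exact: differentiable_cst. Qed.

Lemma cReD (a b : C) : complex.Re (a + b) = complex.Re a + complex.Re b.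
Proof. by case: a b => ? ? []. Qed.

Lemma cImD (a b : C) : complex.Im (a + b) = complex.Im a + complex.Im b.
Proof. by case: a b => ? ? []. Qed.

Lemma cReM (a b : C) : complex.Re (a * b) =
  complex.Re a * complex.Re b - complex.Im a * complex.Im b.
Proof. by case: a b => ? ? []. Qed.

Lemma cImM (a b : C) : complex.Im (a * b) =
  complex.Re a * complex.Im b + complex.Im a * complex.Re b.
Proof. by case: a b => ? ? []. Qed.

Lemma complexP (a b : C) : complex.Re a = complex.Re b ->
  complex.Im a = complex.Im b -> a = b.
Proof. by case: a b => ? ? [] ? ? /= -> ->. Qed.

Lemma cdiffD f g x : cdiff f x -> cdiff g x -> cdiff (fun y => f y + g y) x.
Proof.
move=> [f1 f2] [g1 g2]; split; [under eq_fun do rewrite cReD|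
  under eq_fun do rewrite cImD]; exact: differentiableD.
Qed.

Lemma cdiffM f g x : cdiff f x -> cdiff g x -> cdiff (fun y => f y * g y) x.
Proof.
move=> [f1 f2] [g1 g2]; split.
  under eq_fun do rewrite cReM.
  by apply: differentiableB; exact: differentiableM.
under eq_fun do rewrite cImM.
by apply: differentiableD; exact: differentiableM.
Qed.

Lemma partial_cst (c : C) j : partial j (fun _ : V => c) = fun=> 0.
Proof.
by apply/funext => x; apply: complexP; exact: derive_cst.
Qed.

Lemma partialD f g j x : cdiff f x -> cdiff g x ->
  partial j (fun y => f y + g y) x = partial j f x + partial j g x.
Proof.
move=> [f1 f2] [g1 g2]; apply: complexP; rewrite ?cReD ?cImD /=.
  under eq_fun do rewrite cReD.
  by apply: deriveD; exact: diff_derivable.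
under eq_fun do rewrite cImD.
by apply: deriveD; exact: diff_derivable.
Qed.

Lemma partialM f g j x : cdiff f x -> cdiff g x ->
  partial j (fun y => f y * g y) x = partial j f x * g x + f x * partial j g x.
Proof.
move=> [f1 f2] [g1 g2].
have [d1 d2 d3 d4] : [/\ derivable (fun y => complex.Re (f y)) x (e_ j),
    derivable (fun y => complex.Im (f y)) x (e_ j),
    derivable (fun y => complex.Re (g y)) x (e_ j) &
    derivable (fun y => complex.Im (g y)) x (e_ j)].
  by split; exact: diff_derivable.
have M (a b : V -> R) : derivable a x (e_ j) -> derivable b x (e_ j) ->
    is_derive x (e_ j) (fun y => a y * b y)
      (a x * 'D_(e_ j) b x + b x * 'D_(e_ j) a x).
  by move=> /derivableP da /derivableP db; exact: is_deriveM.
apply: complexP; rewrite ?cReD ?cImD ?cReM ?cImM /=.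
  under eq_fun do rewrite cReM.
  have [_ ->] := is_deriveB (M _ _ d1 d3) (M _ _ d2 d4).
  by ring.
under eq_fun do rewrite cImM.
have [_ ->] := is_deriveD (M _ _ d1 d4) (M _ _ d2 d3).
by ring.
Qed.

Lemma partial_translate f a j :
  partial j (fun y => f (y + a)) = fun x => partial j f (x + a).
Proof.
apply/funext => x; apply: complexP => /=.
  exact: (derive_translate (fun y => complex.Re (f y))).
exact: (derive_translate (fun y => complex.Im (f y))).
Qed.

Lemma cdiff_translate f a x : cdiff f (x + a) -> cdiff (fun y => f (y + a)) x.
Proof.
move=> [f1 f2]; split.
  by apply: (@differentiable_comp _ _ _ _ (fun z => z + a)
    (fun y => complex.Re (f y))).
by apply: (@differentiable_comp _ _ _ _ (fun z => z + a)
  (fun y => complex.Im (f y))).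
Qed.

Lemma partials0 f : partials [::] f = f.
Proof. by []. Qed.

Lemma partials1 f j : partials [:: j] f = partial j f.
Proof. by []. Qed.

Lemma partials_rcons s j f : partials (rcons s j) f = partials s (partial j f).
Proof. by rewrite /partials foldr_rcons. Qed.

Lemma partials_translate s f a :
  partials s (fun y => f (y + a)) = fun x => partials s f (x + a).
Proof. by elim: s => //= j s ->; rewrite partial_translate. Qed.

(** Truncating [smooth] at order [n] makes induction possible: by [csmoothS] the innermost
    derivative is peeled off, which for a product leaves a sum of products of lower order. *)
Definition csmooth n f := forall s x, (size s < n)%N -> cdiff (partials s f) x.

Lemma smoothE f : smooth f <-> forall n, csmooth n f.
Proof.
split; first by move=> sf n s x _; exact: sf.
by move=> sf s x; exact: (sf (size s).+1).
Qed.

Lemma csmoothS n f :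
  csmooth n.+1 f <-> (forall x, cdiff f x) /\ forall j, csmooth n (partial j f).
Proof.
split=> [fn|[fd fn]].
  split=> [x|j s x sn]; first exact: (fn [::]).
  by rewrite -partials_rcons; apply: fn; rewrite size_rcons.
elim/last_ind => [x _|s j _ x]; first exact: fd.
by rewrite size_rcons ltnS partials_rcons => sn; exact: fn.
Qed.

Lemma csmooth_leq m n f : (m <= n)%N -> csmooth n f -> csmooth m f.
Proof. by move=> mn fn s x sm; apply: fn; exact: leq_trans mn. Qed.

Lemma csmoothD n f g :
  csmooth n f -> csmooth n g -> csmooth n (fun y => f y + g y).
Proof.
elim: n f g => [f g _ _ s x //|n IH f g /csmoothS[fd fn] /csmoothS[gd gn]].
apply/csmoothS; split=> [x|j]; first exact: cdiffD.
have -> : partial j (fun y => f y + g y) =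
    fun y => partial j f y + partial j g y.
  by apply/funext => y; exact: partialD.
exact: IH.
Qed.

Lemma csmoothM n f g :
  csmooth n f -> csmooth n g -> csmooth n (fun y => f y * g y).
Proof.
elim: n f g => [f g _ _ s x //|n IH f g fS gS].
have fn := csmooth_leq (leqnSn n) fS; have gn := csmooth_leq (leqnSn n) gS.
have [fd f'n] := (csmoothS _ _).1 fS; have [gd g'n] := (csmoothS _ _).1 gS.
apply/csmoothS; split=> [x|j]; first exact: cdiffM.
have -> : partial j (fun y => f y * g y) =
    fun y => partial j f y * g y + f y * partial j g y.
  by apply/funext => y; exact: partialM.
by apply: csmoothD; exact: IH.
Qed.

Lemma smooth_partial f j : smooth f -> smooth (partial j f).
Proof. by move=> sf s x; rewrite -partials_rcons; exact: sf. Qed.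

Lemma smooth_partials f s : smooth f -> smooth (partials s f).
Proof. by move=> sf; elim: s => //= j s; exact: smooth_partial. Qed.

Lemma smoothD f g : smooth f -> smooth g -> smooth (fun y => f y + g y).
Proof. by rewrite !smoothE => sf sg n; exact: csmoothD. Qed.

Lemma smoothM f g : smooth f -> smooth g -> smooth (fun y => f y * g y).
Proof. by rewrite !smoothE => sf sg n; exact: csmoothM. Qed.

Lemma smooth_cst (c : C) : smooth (fun _ : V => c).
Proof.
have E s : exists b, partials s (fun _ : V => c) = fun=> b.
  elim: s => [|j s [b E]]; first by exists c.
  by exists 0; rewrite /= E partial_cst.
by move=> s x; have [b ->] := E s; exact: cdiff_cst.
Qed.

Lemma smoothZ (c : C) f : smooth f -> smooth (fun y => c * f y).
Proof. by move=> sf; apply: smoothM => //; exact: smooth_cst. Qed.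

Lemma smooth_translate f a : smooth f -> smooth (fun y => f (y + a)).
Proof.
by move=> sf s x; rewrite partials_translate; apply: cdiff_translate; exact: sf.
Qed.

Lemma smooth_exponential f (a : 'I_d -> C) : (forall x, cdiff f x) ->
  (forall j, partial j f = fun x => a j * f x) -> smooth f.
Proof.
move=> fd fE; apply/smoothE => n.
(* The constant is generalized because each derivative multiplies it by some [a j]. *)
suff H m c : csmooth m (fun x => c * f x).
  have := H n 1; rewrite (_ : (fun x => _) = f) //.
  by apply/funext => x; exact: mul1r.
elim: m c => [c s x //|m IH c]; apply/csmoothS; split=> [x|j].
  by apply: cdiffM => //; exact: cdiff_cst.
have -> : partial j (fun x => c * f x) = fun x => (c * a j) * f x.
  apply/funext => x; rewrite (partialM j (cdiff_cst c x) (fd x)).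
  by rewrite partial_cst mul0r add0r fE mulrA.
exact: IH.
Qed.

Lemma partialZ (c : C) f j : (forall x, cdiff f x) ->
  partial j (fun y => c * f y) = fun y => c * partial j f y.
Proof.
move=> fd; apply/funext => x; rewrite (partialM j (cdiff_cst c x) (fd x)).
by rewrite partial_cst mul0r add0r.
Qed.

Lemma partialsZ (c : C) f s : smooth f ->
  partials s (fun y => c * f y) = fun y => c * partials s f y.
Proof.
move=> sf; elim: s => //= j s ->; rewrite partialZ // => x; exact: sf.
Qed.

Lemma partialsD f g s : smooth f -> smooth g ->
  partials s (fun y => f y + g y) = fun y => partials s f y + partials s g y.
Proof.
move=> sf sg; elim: s => //= j s ->.
by apply/funext => x; apply: partialD; [exact: sf|exact: sg].
Qed.

(** The mixed second derivatives are continuous because [smooth] makes every iterated derivative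
    differentiable; real and imaginary parts are treated separately. *)
Lemma partial_comm f i j : smooth f ->
  partial i (partial j f) = partial j (partial i f).
Proof.
move=> sf; apply/funext => x.
have D s y := sf s y.
apply: complexP.
  apply: (@derive_comm _ _ (fun y => complex.Re (f y)) (e_ j) (e_ i)).
  - by move=> y; exact: (D [::] y).1.
  - by move=> y; exact: (D [:: j] y).1.
  - by move=> y; exact: (D [:: i] y).1.
  - exact: differentiable_continuous (D [:: i; j] x).1.
  - exact: differentiable_continuous (D [:: j; i] x).1.
apply: (@derive_comm _ _ (fun y => complex.Im (f y)) (e_ j) (e_ i)).
- by move=> y; exact: (D [::] y).2.
- by move=> y; exact: (D [:: j] y).2.
- by move=> y; exact: (D [:: i] y).2.
- exact: differentiable_continuous (D [:: i; j] x).2.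
- exact: differentiable_continuous (D [:: j; i] x).2.
Qed.

Lemma partials_partial f j s : smooth f ->
  partials s (partial j f) = partial j (partials s f).
Proof.
move=> sf; elim: s => //= i s ->.
by rewrite partial_comm //; exact: smooth_partials.
Qed.

Lemma partials_perm f s t : smooth f -> perm_eq s t ->
  partials s f = partials t f.
Proof.
move=> sf; elim: s t => [t|i s IH t st].
  by rewrite perm_sym => /perm_nilP ->.
have it : i \in t by rewrite -(perm_mem st) mem_head.
case/splitPr: it st => t1 t2 st.
have st' : perm_eq s (t1 ++ t2).
  by move: st; rewrite -[i :: t2]cat1s (permPr (permEl (perm_catCA _ _ _))) perm_cons.
rewrite /= (IH _ st') /partials !foldr_cat /=.
by rewrite -(partials_partial i t1) //; exact: (smooth_partials t2).
Qed.

End SmoothFunctions.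

(** * Plane waves and coordinates *)

Section EuclideanNorm.
Variables (R : realType) (d : nat).
Implicit Types (x y : 'rV[R]_d) (t : R) (j : 'I_d).

Lemma dotvDl x y z : dotv (x + y) z = dotv x z + dotv y z.
Proof. by rewrite -big_split; apply: eq_bigr => i _; rewrite mxE mulrDl. Qed.

Lemma dotvC x y : dotv x y = dotv y x.
Proof. by apply: eq_bigr => i _; rewrite mulrC. Qed.

Lemma dotvDr x y z : dotv x (y + z) = dotv x y + dotv x z.
Proof. by rewrite ![dotv x _]dotvC dotvDl. Qed.

Lemma dotvZl t x y : dotv (t *: x) y = t * dotv x y.
Proof. by rewrite /dotv mulr_sumr; apply: eq_bigr => i _; rewrite mxE mulrA. Qed.

Lemma dotvZr t x y : dotv x (t *: y) = t * dotv x y.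
Proof. by rewrite ![dotv x _]dotvC dotvZl. Qed.

Lemma dotvNl x y : dotv (- x) y = - dotv x y.
Proof. by rewrite -scaleN1r dotvZl mulN1r. Qed.

Lemma dotvNr x y : dotv x (- y) = - dotv x y.
Proof. by rewrite dotvC dotvNl dotvC. Qed.

Lemma dotv_delta x j : dotv x (delta_mx ord0 j) = x ord0 j.
Proof.
rewrite /dotv (bigD1 j) //= big1 => [|i ij]; last first.
  by rewrite mxE (negbTE ij) andbF mulr0.
by rewrite mxE !eqxx mulr1 addr0.
Qed.

Lemma dotv_ge0 x : 0 <= dotv x x.
Proof. by apply: sumr_ge0 => i _; rewrite -expr2 sqr_ge0. Qed.

Lemma enorm_ge0 x : 0 <= enorm x.
Proof. exact: sqrtr_ge0. Qed.

Lemma sqr_enorm x : enorm x ^+ 2 = dotv x x.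
Proof. by rewrite sqr_sqrtr // dotv_ge0. Qed.

Lemma enormZ t x : enorm (t *: x) = `|t| * enorm x.
Proof.
by rewrite /enorm dotvZl dotvZr mulrA sqrtrM ?sqr_ge0 -?expr2 ?sqr_ge0 // sqrtr_sqr.
Qed.

Lemma enormN x : enorm (- x) = enorm x.
Proof. by rewrite -scaleN1r enormZ normrN1 mul1r. Qed.

Lemma enorm0 : enorm (0 : 'rV[R]_d) = 0.
Proof. by rewrite -(scale0r (0 : 'rV[R]_d)) enormZ normr0 mul0r. Qed.

Lemma enorm_delta j : enorm (delta_mx ord0 j : 'rV[R]_d) = 1.
Proof. by rewrite /enorm dotv_delta mxE !eqxx sqrtr1. Qed.

Lemma dotv_le_enorm x y : dotv x y <= enorm x * enorm y.
Proof.
have [xy0|/ltW xy0] := leP (dotv x y) 0.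
  by rewrite (le_trans xy0) // mulr_ge0 ?enorm_ge0.
have nn : 0 <= enorm x * enorm y by rewrite mulr_ge0 ?enorm_ge0.
rewrite -(ler_pXn2r (n := 2)) ?nnegrE // exprMn !sqr_enorm.
pose a := dotv x x; pose b := dotv x y; pose c := dotv y y.
have H t : 0 <= t ^+ 2 * a - 2 * t * b + c.
  have := dotv_ge0 (t *: x - y).
  rewrite dotvDl !dotvDr dotvNl !dotvNr !dotvZl !dotvZr dotvNl [dotv y x]dotvC.
  by rewrite -/a -/b -/c; congr (0 <= _); ring.
rewrite -/a -/b -/c.
have a0 : 0 <= a by exact: dotv_ge0.
have [a00|an0] := eqVneq a 0.
  have [->|b0] := eqVneq b 0; first by rewrite a00 expr0n mul0r.
  (* For [a = 0] the quadratic is the affine function [c - 2 t b], and this [t] gives it the value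
     -1. *)
  have := H ((c + 1) / (2 * b)).
  have -> : ((c + 1) / (2 * b)) ^+ 2 * a - 2 * ((c + 1) / (2 * b)) * b + c = -1.
    by rewrite a00; field.
  by rewrite ler0N1.
(* [b / a] is the minimizer of the quadratic. *)
have := mulr_ge0 (H (b / a)) a0.
have -> : ((b / a) ^+ 2 * a - 2 * (b / a) * b + c) * a = a * c - b ^+ 2.
  by field.
by rewrite subr_ge0.
Qed.

Lemma enormD x y : enorm (x + y) <= enorm x + enorm y.
Proof.
rewrite -(ler_pXn2r (n := 2)) ?nnegrE ?addr_ge0 ?enorm_ge0 //.
rewrite sqr_enorm sqrrD !sqr_enorm dotvDl !dotvDr [dotv y x]dotvC.
rewrite -subr_ge0; set D := (X in 0 <= X).
have -> : D = 2 * (enorm x * enorm y - dotv x y) by rewrite /D; ring.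
by rewrite mulr_ge0 // subr_ge0 dotv_le_enorm.
Qed.

Lemma coord_le_enorm x j : `|x ord0 j| <= enorm x.
Proof.
rewrite -sqrtr_sqr ler_wsqrtr // /dotv (bigD1 j) //= -expr2 lerDl.
by apply: sumr_ge0 => i _; rewrite -expr2 sqr_ge0.
Qed.

(** Comparison through the l1 norm, whence the constant [d] rather than its square root. Derivatives
    and balls use the sup norm, weights the Euclidean one. *)
Lemma enorm_le_mx_norm x : enorm x <= d%:R * `|x|.
Proof.
have cx j : `|x ord0 j| <= `|x|.
  rewrite {2}/Num.norm /= mx_normrE.
  by apply: (le_bigmax _ (fun ij => `|x ij.1 ij.2|) (ord0, j)).
apply: (@le_trans _ _ (\sum_j `|x ord0 j|)); last first.
  apply: (@le_trans _ _ (\sum_(j < d) `|x|)); first exact: ler_sum.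
  by rewrite sumr_const card_ord mulr_natl.
have s0 : 0 <= \sum_j `|x ord0 j| by exact: sumr_ge0.
rewrite -(ler_pXn2r (n := 2)) ?nnegrE ?enorm_ge0 // sqr_enorm expr2 mulr_suml.
apply: ler_sum => j _; apply: (le_trans (ler_norm _)); rewrite normrM.
by apply: ler_wpM2l => //; rewrite (bigD1 j) //= lerDl; exact: sumr_ge0.
Qed.

End EuclideanNorm.

Section PlaneWaves.
Variables (R : realType) (d : nat).
Local Notation V := 'rV[R]_d.
Local Notation C := R[i].
Implicit Types (f g : V -> C) (x y v xi : V) (s : seq 'I_d) (j k : 'I_d).

Definition plane xi : V -> C := fun y => cis (dotv y xi).

Definition coord j : V -> C := fun y => (y ord0 j)%:C.

Lemma differentiable_dotv xi x : differentiable (fun y : V => dotv y xi) x.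
Proof.
have -> : (fun y : V => dotv y xi) =
    \sum_(i < d) (fun y : V => xi ord0 i *: y ord0 i).
  by apply/funext => y; rewrite fct_sumE; apply: eq_bigr => i _; exact: mulrC.
apply: differentiable_sum => i; apply: differentiableZ.
exact: differentiable_coord.
Qed.

Lemma derive_dotv xi x v : 'D_v (fun y : V => dotv y xi) x = dotv v xi.
Proof.
have := is_derive_line (t := 0) (v := v) (differentiable_dotv xi (x + 0 *: v)).
rewrite scale0r addr0 => -[_ <-].
under eq_fun do rewrite dotvDl dotvZl.
rewrite derive_val scaler0 !add0r mul1r; exact: mulr1.
Qed.

Lemma cdiff_plane xi x : cdiff (plane xi) x.
Proof.
split; apply: (differentiable_comp (differentiable_dotv xi x));
  exact/derivable1_diffP.
Qed.

Lemma partial_plane xi j :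
  partial j (plane xi) = fun x => ('i * (xi ord0 j)%:C) * plane xi x.
Proof.
apply/funext => x.
have [dc ds] := cdiff_plane xi x.
have D (g : R -> R) : differentiable (fun y : V => g (dotv y xi)) x ->
    'D_(delta_mx ord0 j) (fun y : V => g (dotv y xi)) x =
    'D_1 (fun s : R => g (dotv x xi + s * xi ord0 j)) 0.
  move=> dg; have := @is_derive_line _ _ _ x (delta_mx ord0 j) 0.
  rewrite scale0r addr0 => /(_ _ dg) [_ <-].
  by under eq_fun do rewrite dotvDl dotvZl [dotv (delta_mx _ _) xi]dotvC dotv_delta.
apply: complexP; rewrite /= (D _ dc, D _ ds) derive_val.
  rewrite mul0r addr0 scaler0 !add0r mul1r; simpc.
  by rewrite mulrC [_%:A]mulr1.
rewrite mul0r addr0 scaler0 !add0r mul1r; simpc.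
by rewrite mulrC [_%:A]mulr1.
Qed.

Lemma smooth_plane xi : smooth (plane xi).
Proof.
by apply: smooth_exponential (cdiff_plane xi) _ => j; exact: partial_plane.
Qed.

Lemma partials_plane xi s : partials s (plane xi) =
  fun x => (\prod_(j <- s) ('i * (xi ord0 j)%:C)) * plane xi x.
Proof.
elim: s => [|j s IH]; first by apply/funext => x; rewrite big_nil mul1r.
rewrite /= IH partialZ; last by move=> x; exact: cdiff_plane.
by apply/funext => x; rewrite partial_plane big_cons mulrCA mulrA.
Qed.

Lemma cmod_plane xi x : cmod (plane xi x) = 1.
Proof. exact: cmod_cis. Qed.

Lemma cmod_partials_plane xi s x (K : R) :
  (forall j, `|xi ord0 j| <= K) -> cmod (partials s (plane xi) x) <= K ^+ size s.
Proof.
move=> xiK; rewrite partials_plane cmodM cmod_plane mulr1.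
elim: s => [|j s IH]; first by rewrite big_nil /cmod /= expr1n expr0n addr0 sqrtr1.
rewrite big_cons cmodM cmodM cmod_i mul1r cmod_real exprS.
by apply: ler_pM => //; exact: cmod_ge0.
Qed.

Lemma cdiff_coord j x : cdiff (coord j) x.
Proof.
by split; [exact: differentiable_coord|exact: differentiable_cst].
Qed.

Lemma partial_coord j k : partial k (coord j) = fun=> (j == k)%:R.
Proof.
apply/funext => x; apply: complexP; last first.
  by rewrite /= derive_cst; case: eqP.
rewrite /=; under eq_fun do rewrite -dotv_delta.
by rewrite derive_dotv dotv_delta mxE eqxx /=; case: eqP.
Qed.

Lemma smooth_coord j : smooth (coord j).
Proof.
apply/smoothE => n; case: n => [s x //|n]; apply/csmoothS; split.
  exact: cdiff_coord.
by move=> k; rewrite partial_coord => s x _; exact: smooth_cst.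
Qed.

Lemma partials_cst (c : C) s : (0 < size s)%N ->
  partials s (fun _ : V => c) = fun=> 0.
Proof.
case: s => // j s _; elim: s j => [|k s IH] j; first exact: partial_cst.
by rewrite -[RHS](partial_cst 0 j) -(IH k).
Qed.

Lemma partials_coord j s : (1 < size s)%N -> partials s (coord j) = fun=> 0.
Proof.
case/lastP: s => // s k; rewrite size_rcons ltnS => s0.
by rewrite partials_rcons partial_coord partials_cst.
Qed.

(* Second-order remainders of modulation and of translation along the [j]th
   axis; the Fourier transform exchanges them (up to the sign of [h]). *)
Definition mremainder j (h : R) : V -> C := fun y =>
  plane (h *: delta_mx ord0 j) y + (- 1 + - ('i * h%:C) * coord j y).

Definition tremainder j (h : R) f : V -> C := fun y =>
  f (y + h *: delta_mx ord0 j) + (- f y + - h%:C * partial j f y).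

Lemma smooth_mremainder j h : smooth (mremainder j h).
Proof.
apply: smoothD; first exact: smooth_plane.
by apply: smoothD; [exact: smooth_cst|apply: smoothZ; exact: smooth_coord].
Qed.

Lemma smoothN f : smooth f -> smooth (fun y => - f y).
Proof.
move=> sf; under eq_fun do rewrite -mulN1r; exact: smoothZ.
Qed.

Lemma partialsN f s : smooth f ->
  partials s (fun y => - f y) = fun y => - partials s f y.
Proof.
move=> sf; under eq_fun do rewrite -mulN1r.
by rewrite partialsZ //; apply/funext => y; rewrite mulN1r.
Qed.

Lemma partials_tremainder j h f s : smooth f ->
  partials s (tremainder j h f) = tremainder j h (partials s f).
Proof.
move=> sf; have sfh := smooth_translate (h *: delta_mx ord0 j) sf.
have sfN := smoothN sf.
have sfj := smoothZ (- h%:C) (smooth_partial j sf).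
rewrite /tremainder partialsD //; last exact: smoothD.
rewrite partialsD // partialsN // partialsZ; last exact: smooth_partial.
by rewrite partials_translate partials_partial.
Qed.

Lemma tremainder_le j h f x (B : R) : smooth f ->
  (forall t : R, `|t| <= `|h| ->
    cmod (partials [:: j; j] f (x + t *: delta_mx ord0 j)) <= B) ->
  cmod (tremainder j h f x) <= 2 * h ^+ 2 * B.
Proof.
move=> sf fB; apply: (le_trans (cmod_le_ReIm _)).
rewrite -mulrA mulr_natl [leRHS]mulr2n.
have D s y := sf s y.
apply: lerD.
  have := @line_taylor2 _ _ (fun y => complex.Re (f y)) x (delta_mx ord0 j) h B
    (fun y => (D [::] y).1) (fun y => (D [:: j] y).1).
  rewrite /tremainder !cReD. rewrite cReM /= oppr0 mul0r subr0 mulNr addrA.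
  case: (f x) => a b; apply => t th.
  exact: le_trans (Re_le_cmod _) (fB t th).
have := @line_taylor2 _ _ (fun y => complex.Im (f y)) x (delta_mx ord0 j) h B
  (fun y => (D [::] y).2) (fun y => (D [:: j] y).2).
rewrite /tremainder !cImD cImM /= oppr0 mul0r addr0 mulNr addrA.
case: (f x) => a b; apply => t th.
exact: le_trans (Im_le_cmod _) (fB t th).
Qed.

End PlaneWaves.

(** * Weighted bounds *)

Section Growth.
Variables (R : realType) (d : nat) (w : R -> R).
Hypothesis hw : weight w.
Local Notation V := 'rV[R]_d.
Local Notation C := R[i].
Implicit Types (f g m : V -> C) (x y v xi : V) (s : seq 'I_d) (j : 'I_d).
Implicit Types (k l A B : R) (N : nat).

Local Notation growth := (growth w).

Lemma growth_gt0 l x : 0 < growth l x.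
Proof. exact: expR_gt0. Qed.

Lemma growth_ge0 l x : 0 <= growth l x.
Proof. exact: expR_ge0. Qed.

Lemma weight_enorm_ge0 x : 0 <= w (enorm x).
Proof. by apply: (weight_ge0 hw); exact: enorm_ge0. Qed.

Lemma growthM k l x : growth (k + l) x = growth k x * growth l x.
Proof. by rewrite /Defs.growth mulrDl expRD. Qed.

Lemma growth0 x : growth 0 x = 1.
Proof. by rewrite /Defs.growth mul0r expR0. Qed.

Lemma growthN l x : growth l x * growth (- l) x = 1.
Proof. by rewrite -growthM subrr growth0. Qed.

Lemma growth_even l x : growth l (- x) = growth l x.
Proof. by rewrite /Defs.growth enormN. Qed.

Lemma ler_growth k l x : k <= l -> growth k x <= growth l x.
Proof. by move=> kl; rewrite ler_expR ler_wpM2r // weight_enorm_ge0. Qed.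

Lemma growth_ge1 l x : 0 <= l -> 1 <= growth l x.
Proof. by move=> l0; rewrite -(growth0 x) ler_growth. Qed.

Lemma growthD l x y : 0 <= l -> growth l (x + y) <= growth l x * growth l y.
Proof.
move=> l0; rewrite /Defs.growth -expRD ler_expR -mulrDr ler_wpM2l //.
apply: le_trans (weight_subadd hw (enorm_ge0 x) (enorm_ge0 y)).
by apply: (weight_homo hw) (enormD _ _); exact: enorm_ge0.
Qed.

(** A Peetre-type inequality: subadditivity applied to [x = (x + y) + (- y)]. Through it, decay
    survives translation. *)
Lemma growthND l x y : 0 <= l ->
  growth (- l) (x + y) <= growth l y * growth (- l) x.
Proof.
move=> l0; have := growthD (x + y) (- y) l0; rewrite addrK growth_even => H.
rewrite -(ler_pM2r (growth_gt0 l (x + y))) mulrC growthN -(growthN l x).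
rewrite [leRHS]mulrC mulrA.
by rewrite ler_wpM2r ?growth_ge0.
Qed.

Lemma growth_ball l x : 0 <= l -> enorm x <= 1 -> growth l x <= expR (l * w 1).
Proof.
move=> l0 x1; rewrite ler_expR ler_wpM2l //.
by apply: (weight_homo hw) x1; exact: enorm_ge0.
Qed.

(** Condition (gamma) with constant 1 gives t <= exp(w(t)) for large t; on the remaining ball the
    weight factor is at least 1. Through this bound powers of exp w absorb polynomials. *)
Lemma enorm_le_growth : exists2 K : R, 1 <= K &
  forall x, 1 + enorm x <= K * growth 1 x.
Proof.
have [T [_ HT]] := weight_ln hw ltr01.
(* Beyond [K] the norm exceeds [T] and is positive, so that its logarithm is meaningful. *)
pose K := 1 + `|T| + 1; have K1 : 1 <= K by rewrite lerDr addr_ge0.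
exists (1 + K) => [|x]; first by rewrite lerDl (le_trans ler01).
have g1 := growth_ge1 x ler01.
have [xK|Kx] := leP (enorm x) K.
  apply: (@le_trans _ _ ((1 + K) * 1)); first by rewrite mulr1 lerD2l.
  by rewrite ler_wpM2l // addr_ge0 // (le_trans ler01).
have x0 : 0 < enorm x by rewrite (lt_le_trans _ (ltW Kx)) // (lt_le_trans ltr01).
rewrite mulrDl mul1r lerD //; apply: (@le_trans _ _ (growth 1 x)); last first.
  by rewrite ler_peMl ?growth_ge0.
have Tx : T < enorm x.
  rewrite (le_lt_trans (ler_norm T)) // (lt_trans _ Kx) //.
  by rewrite /K addrAC ltr_pwDl // lerDl.
have := HT _ Tx; rewrite !mul1r (ger0_norm (weight_enorm_ge0 x)) => wx.
rewrite /Defs.growth mul1r -[leLHS](lnK x0) ler_expR.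
exact: le_trans (ler_norm _) wx.
Qed.

(** Words of axes replace multi-indices, so that the product rule acts by induction on the innermost
    derivative. Decay at rate [l] is expressed by the exponent [- l]. *)
Definition bnd N l B f := forall s, (size s <= N)%N ->
  forall x, cmod (partials s f x) <= B * growth l x.

Lemma bnd_ge0 N l B f : bnd N l B f -> 0 <= B.
Proof.
move=> /(_ [::] isT 0) /(le_trans (cmod_ge0 _)).
by rewrite pmulr_lge0 // growth_gt0.
Qed.

Lemma bnd_le N N' l l' B B' f : (N' <= N)%N -> l <= l' -> B <= B' ->
  bnd N l B f -> bnd N' l' B' f.
Proof.
move=> NN ll BB fB s sN x; apply: (le_trans (fB s (leq_trans sN NN) x)).
by apply: ler_pM; rewrite ?(bnd_ge0 fB) ?growth_ge0 ?ler_growth.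
Qed.

Lemma bnd_partial N l B j f : bnd N.+1 l B f -> bnd N l B (partial j f).
Proof.
by move=> fB s sN x; rewrite -partials_rcons; apply: fB; rewrite size_rcons.
Qed.

Lemma bndD N l A B f g : smooth f -> smooth g ->
  bnd N l A f -> bnd N l B g -> bnd N l (A + B) (fun y => f y + g y).
Proof.
move=> sf sg fA gB s sN x; rewrite partialsD // mulrDl.
by apply: (le_trans (cmodD _ _)); rewrite lerD ?fA ?gB.
Qed.

Lemma bndZ N l B (c : C) f : smooth f ->
  bnd N l B f -> bnd N l (cmod c * B) (fun y => c * f y).
Proof.
move=> sf fB s sN x; rewrite partialsZ // cmodM -mulrA.
by rewrite ler_wpM2l ?cmod_ge0 ?fB.
Qed.

(** Each derivative at most doubles the number of terms in the Leibniz rule, whence [2 ^+ N]. *)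
Lemma bndM N k l A B f g : smooth f -> smooth g ->
  bnd N k A f -> bnd N l B g ->
  bnd N (k + l) (2 ^+ N * A * B) (fun y => f y * g y).
Proof.
elim: N f g => [|N IH] f g sf sg fA gB s.
  rewrite leqn0 size_eq0 => /eqP -> x /=; rewrite expr0 mul1r cmodM growthM.
  rewrite mulrACA; apply: ler_pM; rewrite ?cmod_ge0 //.
    exact: (fA [::]).
  exact: (gB [::]).
have A0 := bnd_ge0 fA; have B0 := bnd_ge0 gB.
have fA' := bnd_le (leqnSn N) (lexx k) (lexx A) fA.
have gB' := bnd_le (leqnSn N) (lexx l) (lexx B) gB.
case/lastP: s => [_ x|s j].
  apply: (@le_trans _ _ (A * B * growth (k + l) x)).
    rewrite /= cmodM growthM mulrACA.
    apply: ler_pM; rewrite ?cmod_ge0 //; first exact: (fA [::]).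
    exact: (gB [::]).
  rewrite ler_wpM2r ?growth_ge0 // -mulrA ler_peMl ?mulr_ge0 //.
  by rewrite exprn_ege1 // ler1n.
rewrite size_rcons ltnS partials_rcons => sN x.
have -> : partial j (fun y => f y * g y) =
    fun y => partial j f y * g y + f y * partial j g y.
  by apply/funext => y; apply: partialM; [exact: sf [::] y|exact: sg [::] y].
have sf' := smooth_partial j sf; have sg' := smooth_partial j sg.
rewrite partialsD; [|exact: smoothM..].
apply: (le_trans (cmodD _ _)).
rewrite exprS -!mulrA mulr_natl mulr2n lerD //.
  by rewrite !mulrA; apply: IH => //; exact: bnd_partial.
by rewrite !mulrA; apply: IH => //; exact: bnd_partial.
Qed.

Lemma bnd_translate N l B f a : 0 <= l -> bnd N (- l) B f ->
  bnd N (- l) (growth l a * B) (fun y => f (y + a)).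
Proof.
move=> l0 fB s sN x; rewrite partials_translate.
apply: (le_trans (fB s sN _)); rewrite -mulrA mulrCA.
by rewrite ler_wpM2l ?(bnd_ge0 fB) // growthND.
Qed.

Lemma bnd_plane N xi : bnd N 0 ((1 + enorm xi) ^+ N) (plane xi).
Proof.
move=> s sN x; rewrite growth0 mulr1.
have x1 : 1 <= 1 + enorm xi by rewrite lerDl enorm_ge0.
apply: (le_trans (cmod_partials_plane s x (K := 1 + enorm xi) _)).
  by move=> j; rewrite (le_trans (coord_le_enorm _ _)) // lerDr.
exact: ler_weXn2l.
Qed.

(** [K] does not depend on [N], since first derivatives of a coordinate are 0 or 1 and higher ones
    vanish. *)
Lemma bnd_coord : exists2 K, 1 <= K & forall N j, bnd N 1 K (coord j).
Proof.
have [K K1 HK] := enorm_le_growth; exists K => // N j s _ x.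
have HK' : 1 <= K * growth 1 x.
  by rewrite (le_trans _ (HK x)) // lerDl enorm_ge0.
case: s => [|k [|k' s]].
- rewrite partials0 /coord cmod_real.
  rewrite (le_trans (coord_le_enorm _ _)) //.
  by rewrite (le_trans _ (HK x)) // lerDr.
- rewrite partials1 partial_coord (le_trans _ HK') //; case: eqP => _.
    by rewrite /cmod /= expr1n expr0n addr0 sqrtr1.
  by rewrite cmod0.
- by rewrite partials_coord // cmod0 (le_trans _ HK').
Qed.

(** At order 0 the Taylor bound gives the square of [h x_j]; at order 1 along axis [j] the factor
    [i h (cis (h x_j) - 1)] is bounded by a multiple of [h^2 |x_j|]; from order 2 on only the plane
    wave is left, whose derivatives are at most [h^2] for |h| <= 1. The exponent 2 absorbs the
    square of |x|. *)
Lemma bnd_mremainder : exists2 K, 0 <= K & forall N j (h : R), `|h| <= 1 ->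
  bnd N 2 (K * h ^+ 2) (mremainder j h).
Proof.
have [K K1 HK] := enorm_le_growth.
have K0 : 0 <= K by exact: le_trans ler01 K1.
exists (2 * K ^+ 2) => [|N j h h1 s _ x]; first by rewrite mulr_ge0 ?sqr_ge0.
have h2 : 0 <= h ^+ 2 by exact: sqr_ge0.
have gE : growth 2 x = growth 1 x ^+ 2 by rewrite expr2 -growthM.
have KG : 1 + enorm x <= K * growth 1 x by exact: HK.
have G1 : 1 <= K * growth 1 x by rewrite (le_trans _ KG) // lerDl enorm_ge0.
have xG : `|x ord0 j| <= K * growth 1 x.
  by rewrite (le_trans (coord_le_enorm _ _)) // (le_trans _ KG) // lerDr.
have -> : 2 * K ^+ 2 * h ^+ 2 * growth 2 x =
  2 * (h ^+ 2 * (K * growth 1 x) ^+ 2) by rewrite gE; ring.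
have dE : dotv x (h *: delta_mx ord0 j) = h * x ord0 j.
  by rewrite dotvZr dotv_delta.
case: s => [|k [|k' s]].
- rewrite partials0 /mremainder /plane /coord dE.
  have -> : cis (h * x ord0 j) + (- 1 + - ('i * h%:C) * (x ord0 j)%:C) =
      cis (h * x ord0 j) - 1 - 'i * (h * x ord0 j)%:C.
    by rewrite rmorphM; ring.
  apply: (le_trans (cis_taylor2 _)); rewrite exprMn ler_wpM2l // ler_wpM2l //.
  rewrite -[leLHS]ger0_norm ?sqr_ge0 // normrX ler_pXn2r ?nnegrE //.
  by rewrite (le_trans _ G1).
- rewrite partials1 partialD; first last.
  + apply: cdiffD; first exact: cdiff_cst.
    by apply: cdiffM; [exact: cdiff_cst|exact: cdiff_coord].
  + exact: cdiff_plane.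
  rewrite partialD; first last.
  + by apply: cdiffM; [exact: cdiff_cst|exact: cdiff_coord].
  + exact: cdiff_cst.
  rewrite partial_cst add0r partialZ; last by move=> y; exact: cdiff_coord.
  rewrite partial_plane partial_coord !mxE eqxx /= eq_sym.
  case: eqP => _; last first.
    by rewrite !mulr0 mul0r addr0 cmod0 mulr_ge0 // mulr_ge0 // sqr_ge0.
  rewrite /plane dE [X in cmod X](_ : _ = 'i * h%:C * (cis (h * x ord0 j) - 1)).
    2: by rewrite /= !mulr1; ring.
  rewrite !cmodM cmod_i mul1r cmod_real.
  apply: (le_trans (ler_wpM2l (normr_ge0 _) (cis_taylor1 _))).
  rewrite normrM [leLHS](_ : _ = 2 * (`|h| ^+ 2 * `|x ord0 j|)); last by ring.
  rewrite -normrX (ger0_norm h2) ler_wpM2l // ler_wpM2l //.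
  by rewrite (le_trans xG) // expr2 ler_peMl // (le_trans _ G1).
- rewrite /mremainder partialsD; first last.
  + by apply: smoothD; [exact: smooth_cst|apply: smoothZ; exact: smooth_coord].
  + exact: smooth_plane.
  rewrite partialsD; first last.
  + by apply: smoothZ; exact: smooth_coord.
  + exact: smooth_cst.
  rewrite partials_cst // add0r partialsZ; last exact: smooth_coord.
  rewrite partials_coord // mulr0 addr0.
  apply: (le_trans (cmod_partials_plane _ x (K := `|h|) _)).
    move=> i; rewrite !mxE normrM eqxx /= ler_piMr //.
    by case: eqP; rewrite ?normr1 ?normr0.
  have -> : `|h| ^+ size [:: k, k' & s] = h ^+ 2 * `|h| ^+ size s.
    by rewrite /= -addn2 exprD mulrC -normrX (ger0_norm h2).
  apply: (@le_trans _ _ (h ^+ 2)).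
    by rewrite ler_piMr // exprn_ile1.
  by rewrite mulrCA ler_peMr // mulr_ege1 ?ler1n // exprn_ege1.
Qed.

(** Taylor's formula consumes two derivatives of [f], and [expR (l * w 1)] is the price of moving
    the weight from [x + t e_j] back to [x] when |t| <= 1. *)
Lemma bnd_tremainder N l B j (h : R) f : smooth f -> 0 <= l -> `|h| <= 1 ->
  bnd N.+2 (- l) B f ->
  bnd N (- l) (2 * h ^+ 2 * (expR (l * w 1) * B)) (tremainder j h f).
Proof.
move=> sf l0 h1 fB s sN x; rewrite partials_tremainder // -2!mulrA mulrA.
apply: tremainder_le => [|t th]; first exact: smooth_partials.
have := fB ([:: j; j] ++ s); rewrite /partials foldr_cat -/(partials _ _) => H.
apply: (le_trans (H _ _)); first by rewrite /= !ltnS.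
rewrite mulrC -mulrA [X in _ <= _ * X]mulrC mulrA ler_wpM2r ?(bnd_ge0 fB) //.
apply: (le_trans (growthND _ _ l0)); rewrite ler_wpM2r ?growth_ge0 //.
apply: growth_ball => //; rewrite enormZ enorm_delta mulr1.
exact: le_trans h1.
Qed.

(** [l] ranges over all reals; its negative values express decay. *)
Definition rapid f := smooth f /\ forall N l, exists B, bnd N l B f.

Lemma rapid_partial j f : rapid f -> rapid (partial j f).
Proof.
move=> [sf rf]; split; first exact: smooth_partial.
by move=> N l; have [B fB] := rf N.+1 l; exists B; exact: bnd_partial.
Qed.

Lemma rapidD f g : rapid f -> rapid g -> rapid (fun y => f y + g y).
Proof.
move=> [sf rf] [sg rg]; split; first exact: smoothD.
move=> N l; have [A fA] := rf N l; have [B gB] := rg N l.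
by exists (A + B); exact: bndD.
Qed.

Lemma rapidZ (c : C) f : rapid f -> rapid (fun y => c * f y).
Proof.
move=> [sf rf]; split; first exact: smoothZ.
by move=> N l; have [A fA] := rf N l; exists (cmod c * A); exact: bndZ.
Qed.

(** The exponent [k] of the multiplier is the same at all orders, so it suffices to ask the exponent
    [l - k] of [f]. *)
Lemma rapidM k m f : smooth m -> (forall N, exists A, bnd N k A m) ->
  rapid f -> rapid (fun y => m y * f y).
Proof.
move=> sm rm [sf rf]; split; first exact: smoothM.
move=> N l; have [A mA] := rm N; have [B fB] := rf N (l - k).
by exists (2 ^+ N * A * B); rewrite -[l](subrKC k); exact: bndM.
Qed.

Lemma rapid_coord j f : rapid f -> rapid (fun y => coord j y * f y).
Proof.
apply: (@rapidM 1); first exact: smooth_coord.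
by move=> N; have [K _ HK] := bnd_coord; exists K.
Qed.

Lemma rapid_plane xi f : rapid f -> rapid (fun y => plane xi y * f y).
Proof.
apply: (@rapidM 0); first exact: smooth_plane.
by move=> N; eexists; exact: bnd_plane.
Qed.

Lemma rapid_mremainder j h f : `|h| <= 1 -> rapid f ->
  rapid (fun y => mremainder j h y * f y).
Proof.
move=> h1; apply: (@rapidM 2); first exact: smooth_mremainder.
by move=> N; have [K _ HK] := bnd_mremainder; eexists; exact: HK.
Qed.

Lemma rapid_translate a f : rapid f -> rapid (fun y => f (y + a)).
Proof.
move=> [sf rf]; split; first exact: smooth_translate.
move=> N l; have [B fB] := rf N (- `|l|); exists (growth `|l| a * B).
apply: (@bnd_le N _ (- `|l|)) (bnd_translate a (normr_ge0 l) fB) => //.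
by rewrite lerNl -normrN ler_norm.
Qed.

End Growth.

(** * Integration over tuples *)

Section TupleIntegrals.
Variable R : realType.
Local Notation T := (measurableTypeR R).
Local Notation mu n := (lebesgue_tuple R n).

Definition rowt n (t : n.-tuple T) : 'rV[R]_n := \row_j tnth t j.

Definition shiftt n (a t : n.-tuple T) : n.-tuple T :=
  [tuple (tnth t j + tnth a j : T) | j < n].

(** The common integrable majorant. It is a product over the coordinates, so its integral is
    computed by induction on the dimension. *)
Definition cauchy_density n (t : n.-tuple T) : R :=
  \prod_(j < n) (1 + tnth t j ^+ 2)^-1.

Lemma measurable_shiftt n (a : n.-tuple T) : measurable_fun setT (shiftt a).
Proof.
apply/measurable_fun_tnthP => i.
rewrite [X in measurable_fun _ X](_ : _ = fun t => tnth t i + tnth a i); last first.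
  by apply/funext => t /=; rewrite tnth_mktuple.
by apply: measurable_funD => //; exact: measurable_tnth.
Qed.

(** The image of Lebesgue measure under a translation has the right value on half-open intervals,
    hence is Lebesgue measure by uniqueness. *)
Lemma ge0_integral_translate1 (a : R) (f : T -> \bar R) :
  measurable_fun setT f -> (forall x, (0 <= f x)%E) ->
  (\int[@lebesgue_measure R]_x f (x + a)%R = \int[@lebesgue_measure R]_x f x)%E.
Proof.
move=> mf f0; pose sh (x : T) : T := x + a.
have msh : measurable_fun setT sh by exact: measurable_funD.
have := ge0_integral_pushforward msh (@lebesgue_measure R) measurableT mf.
rewrite preimage_setT => <- //.
apply: eq_measure_integral => /= A mA _; apply/esym/lebesgue_measure_unique => //=.
move=> _ [[x y] _ <-]; rewrite /pushforward /=.
have -> : sh @^-1` `]x, y]%classic = `](x - a), (y - a)]%classic.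
  apply/seteqP; split=> z /=; rewrite !in_itv /= /sh;
    by rewrite ltrBlDr lerBrDr.
rewrite !lebesgue_measure_itv /= !lte_fin ltrD2r.
by case: ifP => // _; rewrite -!EFinB opprD addrACA subrr addr0.
Qed.

Lemma ge0_integral_tupleS n (f : n.+1.-tuple T -> \bar R) :
  measurable_fun setT f -> (forall t, (0 <= f t)%E) ->
  (\int[mu n.+1]_t f t =
   \int[@lebesgue_measure R]_x \int[mu n]_t f (tcons (x, t)))%E.
Proof.
move=> mf f0.
have mc := @measurable_tcons R n.
rewrite (ge0_integral_pushforward mc (@lebesgue_measure R \x mu n)%E measurableT mf) //.
rewrite preimage_setT fubini_tonelli1 //=.
by apply: measurableT_comp.
Qed.

Lemma tnth_tcons0 n (p : T * n.-tuple T) : tnth (tcons p) ord0 = p.1.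
Proof. by []. Qed.

Lemma tnth_tconsS n (p : T * n.-tuple T) j :
  tnth (tcons p) (lift ord0 j) = tnth p.2 j.
Proof. by rewrite tnthS. Qed.

Lemma tcons_eta n (t : n.+1.-tuple T) :
  t = tcons (thead t, [tuple of behead t]).
Proof. by case/tupleP: t => x t; apply: val_inj. Qed.

Lemma measurable_tcons2 n (x : T) : measurable_fun setT
  (fun t : n.-tuple T => tcons (x, t)).
Proof.
exact: (measurable_cons (measurable_cst _) (@measurable_id _ _ setT)).
Qed.

(** By Tonelli, the tail is shifted by induction under the outer integral and the head by the
    one-dimensional case. *)
Lemma ge0_integral_translate n (a : n.-tuple T) (f : n.-tuple T -> \bar R) :
  measurable_fun setT f -> (forall t, (0 <= f t)%E) ->
  (\int[mu n]_t f (shiftt a t) = \int[mu n]_t f t)%E.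
Proof.
elim: n a f => [a f mf f0|n IH a f mf f0].
  by apply: eq_integral => t _; congr f; rewrite [LHS]tuple0 [RHS]tuple0.
have ms := measurable_shiftt a.
rewrite !ge0_integral_tupleS //; last exact: measurableT_comp.
have E x t : shiftt a (tcons (x, t)) =
    tcons (x + thead a, shiftt [tuple of behead a] t).
  apply: eq_from_tnth => i; rewrite tnth_mktuple.
  case: (unliftP ord0 i) => [j|] ->; last by rewrite !tnth_tcons0.
  by rewrite !tnth_tconsS tnth_mktuple /= {1}(tcons_eta a) tnth_tconsS.
pose F x := (\int[mu n]_t f (tcons (x, t)))%E.
transitivity (\int[@lebesgue_measure R]_x F (x + thead a)%R)%E.
  apply: eq_integral => x _; under eq_integral do rewrite E.
  rewrite (IH [tuple of behead a] (fun t => f (tcons (x + thead a, t)))) //.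
  apply: (measurableT_comp mf); exact: measurable_tcons2.
apply: ge0_integral_translate1 => [|x]; last exact: integral_ge0.
apply: (@measurable_fun_fubini_tonelli_F _ _ _ _ _ (mu n) (fun p => f (tcons p))) => //.
by apply: (measurableT_comp mf); exact: measurable_tcons.
Qed.

Lemma cauchy_density_ge0 n (t : n.-tuple T) : 0 <= cauchy_density t.
Proof. by apply: prodr_ge0 => j _; rewrite invr_ge0 addr_ge0 // sqr_ge0. Qed.

Lemma measurable_cauchy1 : measurable_fun setT (fun x : T => (1 + x ^+ 2)^-1 : R).
Proof.
apply: continuous_measurable_fun; exact: continuous_oneDsqrV.
Qed.

Lemma measurable_cauchy_density n : measurable_fun setT (@cauchy_density n).
Proof.
apply: measurable_prod => j _.
by apply: (measurableT_comp measurable_cauchy1); exact: measurable_tnth.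
Qed.

Lemma integral_cauchy1 :
  (\int[@lebesgue_measure R]_x ((1 + x ^+ 2)^-1)%:E < +oo)%E.
Proof.
rewrite ge0_symfun_integralT.
- rewrite (_ : [set x : R | _] = `[0%R, +oo[%classic); last first.
    by apply/seteqP; split => x /=; rewrite in_itv /= andbT.
  by rewrite integral0y_oneDsqr -EFinM ltry.
- by move=> x; rewrite invr_ge0 addr_ge0 // sqr_ge0.
- exact: continuous_oneDsqrV.
- by move=> x /=; rewrite sqrrN.
Qed.

Lemma integral_cauchy_density n : (\int[mu n]_t (cauchy_density t)%:E < +oo)%E.
Proof.
have mc m : measurable_fun setT (fun t : m.-tuple T => (cauchy_density t)%:E).
  by apply/measurable_EFinP; exact: measurable_cauchy_density.
elim: n => [|n IH].
  rewrite integral_dirac //; last exact: mc.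
  by rewrite diracE in_setT mul1e ltry.
rewrite ge0_integral_tupleS; first last.
- by move=> t; rewrite lee_fin cauchy_density_ge0.
- exact: mc.
under eq_integral => x _.
  under eq_integral => t _.
    rewrite /cauchy_density big_ord_recl tnth_tcons0.
    under eq_bigr do rewrite tnth_tconsS.
    rewrite -/(cauchy_density t) EFinM /=.
    over.
  rewrite ge0_integralZl //=; first last.
  - by rewrite lee_fin invr_ge0 addr_ge0 // sqr_ge0.
  - by move=> t _; rewrite lee_fin cauchy_density_ge0.
  - exact: mc.
  over.
rewrite /= ge0_integralZr //=.
- rewrite lte_mul_pinfty //.
  + by apply: integral_ge0 => x _; rewrite lee_fin invr_ge0 addr_ge0 // sqr_ge0.
  + rewrite ge0_fin_numE ?integral_cauchy1 //.
    by apply: integral_ge0 => x _; rewrite lee_fin invr_ge0 addr_ge0 // sqr_ge0.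
- by apply/measurable_EFinP; exact: measurable_cauchy1.
- by move=> x _; rewrite lee_fin invr_ge0 addr_ge0 // sqr_ge0.
- by apply: integral_ge0 => t _; rewrite lee_fin cauchy_density_ge0.
Qed.

(* Every open set of row vectors is a countable union of half-open cubes with
   vertices in a grid of mesh 1 / n.+1. *)
Lemma continuous_measurable_rowt n (f : 'rV[R]_n -> R) :
  continuous f -> measurable_fun setT (f \o @rowt n : n.-tuple T -> R).
Proof.
move=> cf; apply: (measurability _ (RGenOInfty.measurableE R)).
move=> /= _ [_ [a ->]] <-; rewrite setTI.
pose U := f @^-1` `]a, +oo[%classic.
have oU : open U.
  by apply: open_comp => [x _|]; [exact: cf|exact: interval_open].
pose box (p : {ffun 'I_n -> int} * nat) : set (n.-tuple T) :=
  [set t | forall j, Num.floor (p.2.+1%:R * tnth t j) = p.1 j].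
have mbox p : measurable (box p).
  have -> : box p = \bigcap_(j in [set: 'I_n])
      ((fun t : n.-tuple T => tnth t j) @^-1`
       `[((p.1 j)%:~R / p.2.+1%:R), ((p.1 j + 1)%:~R / p.2.+1%:R)[%classic).
    apply/seteqP; split=> t /= tp j; [move=> _|]; have := tp j;
      rewrite /= in_itv /= ler_pdivrMr // ltr_pdivlMr // mulrC.
      by move=> <-; exact: floor_itv.
    by move=> /(_ I); exact: floor_def.
  apply: fin_bigcap_measurable => [|j _]; first exact: finite_finset.
  rewrite -[X in measurable X]setTI; apply: measurable_tnth => //.
rewrite [X in measurable X](_ : _ = \bigcup_p
   (if `[< forall t, box p t -> U (rowt t) >] then box p else set0)).
  apply: countable_bigcupT_measurable => // p.
  by case: ifP.
apply/seteqP; split=> [t Ut|t [p _]]; last first.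
  by case: asboolP => // H /H.
have [e /= e0 eU] : exists2 e : R, 0 < e & ball (rowt t) e `<=` U.
  by apply/nbhs_ballP; apply: oU.
(* The mesh [1 / m.+1] is then smaller than the radius [e], so the grid cube of [t] lies in the
   ball. *)
pose m := Num.truncn (e^-1).
have me : e^-1 < m.+1%:R by exact: truncnS_gt.
exists ([ffun j => Num.floor (m.+1%:R * tnth t j)], m) => //.
case: asboolP; first by move=> _ j; rewrite ffunE.
case=> t' /= tt'; apply: eU.
rewrite -ball_normE /ball_ /=.
rewrite (@le_lt_trans _ _ (m.+1%:R)^-1) //; last by rewrite invf_plt ?posrE.
rewrite {1}/Num.norm /= mx_normrE; apply: bigmax_le => [|[i j] _ /=].
  by rewrite invr_ge0.
rewrite !mxE; have := tt' j; rewrite ffunE => /= fE.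
have := floor_itv (m.+1%:R * tnth t j); have := floor_itv (m.+1%:R * tnth t' j).
rewrite fE intrD; set k := (Num.floor _)%:~R => /andP[h1 h2] /andP[h3 h4].
rewrite -(ler_pM2l (_ : 0 < m.+1%:R)) // mulfV ?pnatr_eq0 //.
rewrite -[X in X * _]normr_nat -normrM mulrBr ler_norml.
by apply/andP; split; lra.
Qed.

End TupleIntegrals.

(** * The Fourier transform *)

Section QuadraticRemainder.
Variables (R : realType) (V : normedModType R).

(** A quadratic bound on increments is a little-o. This is how Fourier transforms are differentiated
    below. *)
Lemma is_diff_quadratic0 (r : V -> R) x (B : R) :
  (forall v, `|r (x + v) - r x| <= B * `|v| ^+ 2) ->
  differentiable r x /\ forall v, 'D_v r x = 0.
Proof.
move=> rB.
have B0 : 0 <= `|B| + 1 by rewrite addr_ge0.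
have H : r \o shift x = cst (r x) + (\0 : V -> R) +o_ (0 : V) id.
  apply/eqaddoP => _ /posnumP[e]; apply/nbhs_ballP.
  exists (e%:num / (`|B| + 1)) => [|v] /=.
    by rewrite divr_gt0 // ltr_wpDl.
  rewrite -ball_normE /ball_ /= sub0r normrN => ve.
  rewrite !fctE /= addr0 [v + x]addrC.
  apply: (le_trans (rB v)); rewrite expr2 mulrA ler_wpM2r //.
  apply: (@le_trans _ _ ((`|B| + 1) * `|v|)).
    by rewrite ler_wpM2r // (le_trans (ler_norm _)) // lerDl.
  by rewrite mulrC -ler_pdivlMr ?ltr_wpDl // ltW.
have c0 : continuous (\0 : V -> R) by move=> ?; exact: cst_continuous.
have d0 := @diff_unique R V R r \0 x c0 H.
have dr : differentiable r x by apply/diff_locallyP; rewrite d0.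
by split=> // v; rewrite deriveE // d0.
Qed.

End QuadraticRemainder.

Section Fourier.
Variables (R : realType) (d : nat) (w : R -> R).
Hypothesis hw : weight w.
Local Notation V := 'rV[R]_d.
Local Notation C := R[i].
Local Notation mu := (lebesgue_tuple R d).
Local Notation rowt := (@rowt R d).
Local Notation rapid := (@rapid R d w).
Local Notation bnd := (@bnd R d w).
Implicit Types (f g : V -> C) (x y v xi eta : V) (s : seq 'I_d) (j : 'I_d).
Implicit Types (l A B : R) (N : nat).

Lemma quadratic_differentiable (g : V -> R) (x a : V) (B : R) :
  (forall v, `|g (x + v) - g x - dotv v a| <= B * `|v| ^+ 2) ->
  differentiable g x /\ forall v, 'D_v g x = dotv v a.
Proof.
move=> gB; pose r y := g y - dotv y a.
have [dr Dr] : differentiable r x /\ forall v, 'D_v r x = 0.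
  apply: (@is_diff_quadratic0 _ _ _ _ B) => v.
  apply: le_trans (gB v); rewrite le_eqVlt; apply/orP; left; apply/eqP.
  by congr (`| _ |); rewrite /r dotvDl; ring.
have dl := differentiable_dotv a x.
have gE : g = (r + (fun y => dotv y a)) by apply/funext => y; rewrite fctE /r subrK.
split; first by rewrite gE; exact: differentiableD.
move=> v; rewrite gE deriveD; [|exact: diff_derivable..].
by rewrite Dr add0r derive_dotv.
Qed.

Lemma rapid_continuous f : rapid f ->
  continuous (fun x => complex.Re (f x)) /\
  continuous (fun x => complex.Im (f x)).
Proof.
move=> [sf _]; split=> x; apply: differentiable_continuous.
  exact: (sf [::] x).1.
exact: (sf [::] x).2.
Qed.

Lemma growthX (n : nat) l x : growth w (n%:R * l) x = growth w l x ^+ n.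
Proof. by rewrite /growth -mulrA expRM_natl. Qed.

(* An exponent for which [growth w (- dimb)] is integrable on R^d, by comparison
   with [cauchy_density]. *)
Definition dimb : R := d%:R * 2.

(** [growth w dimb] is a product of [d] copies of [growth w 2], each of which dominates [1 + t_j^2]
    up to the factor [K ^+ 2]. *)
Lemma growth_le_cauchy : exists2 M : R, 0 <= M & forall t,
  growth w (- dimb) (rowt t) <= M * cauchy_density t.
Proof.
have [K K1 HK] := enorm_le_growth d hw.
have K0 : 0 <= K by exact: le_trans ler01 K1.
exists ((K ^+ 2) ^+ d) => [|t]; first by rewrite exprn_ge0 // sqr_ge0.
have P0 : 0 < \prod_(j < d) (1 + tnth t j ^+ 2).
  by apply: prodr_gt0 => j _; rewrite ltr_wpDr // sqr_ge0.
rewrite /cauchy_density prodfV -(ler_pM2r P0) -mulrA mulVf ?gt_eqF // mulr1.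
rewrite -(ler_pM2l (growth_gt0 w dimb (rowt t))) mulrA growthN mul1r.
rewrite /dimb growthX mulrC -exprMn.
rewrite -[X in _ <= _ ^+ X]card_ord -prodr_const; apply: ler_prod => j _.
rewrite addr_ge0 ?sqr_ge0 //=.
have -> : growth w 2 (rowt t) = growth w 1 (rowt t) ^+ 2 by rewrite expr2 -growthM.
rewrite -exprMn; apply: le_trans (_ : (1 + enorm (rowt t)) ^+ 2 <= _).
  have := coord_le_enorm (rowt t) j; rewrite mxE => tj.
  have := enorm_ge0 (rowt t) => e0.
  rewrite sqrrD expr1n mul1r -addrA lerD2l -[leLHS]add0r lerD ?mulrn_wge0 //.
  by rewrite -[leLHS]ger0_norm ?sqr_ge0 // normrX ler_pXn2r ?nnegrE.
by rewrite ler_pXn2r ?nnegrE ?addr_ge0 ?enorm_ge0 ?mulr_ge0 ?growth_ge0.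
Qed.

Lemma integrable_cauchy_density :
  mu.-integrable setT (EFin \o @cauchy_density R d).
Proof.
apply/integrableP; split.
  by apply/measurable_EFinP; exact: measurable_cauchy_density.
have -> : (\int[mu]_t `|(EFin \o @cauchy_density R d) t| =
           \int[mu]_t (cauchy_density t)%:E)%E.
  by apply: eq_integral => t _; rewrite /= ger0_norm ?cauchy_density_ge0.
exact: integral_cauchy_density.
Qed.

Lemma integrable_dominated (g : V -> R) (B : R) : continuous g ->
  (forall t, `|g (rowt t)| <= B * cauchy_density t) ->
  mu.-integrable setT (EFin \o (g \o rowt)).
Proof.
move=> cg gB.
apply: (@le_integrable _ _ _ _ _ _ _ (EFin \o (fun t => B * cauchy_density t))) => //.
- by apply/measurable_EFinP; exact: continuous_measurable_rowt.
- by move=> t _ /=; rewrite lee_fin (le_trans (gB t)) // ler_norm.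
- exact: (integrableZl measurableT B integrable_cauchy_density).
Qed.

Lemma integral_dominated (g : V -> R) (B : R) : continuous g ->
  (forall t, `|g (rowt t)| <= B * cauchy_density t) ->
  `|integral_rV g| <= B * \int[mu]_t cauchy_density t.
Proof.
move=> cg gB; have ig := integrable_dominated cg gB.
rewrite -RintegralZl //; last exact: integrable_cauchy_density.
apply: (le_trans (le_normr_Rintegral _ ig)) => //.
apply: le_Rintegral => //.
- by have := integrable_norm ig; exact.
- exact: (integrableZl measurableT B integrable_cauchy_density).
- by move=> t _; exact: gB.
Qed.

(** Positive and negative parts are translated separately by [ge0_integral_translate]. *)
Lemma integral_translate (g : V -> R) a : continuous g ->
  integral_rV (fun x => g (x + a)) = integral_rV g.
Proof.
move=> cg; pose at_ : d.-tuple (measurableTypeR R) := [tuple (a ord0 j : R) | j < d].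
have shE t : rowt (shiftt at_ t) = rowt t + a.
  by apply/rowP => j; rewrite !mxE !tnth_mktuple.
have mg : measurable_fun setT (EFin \o (g \o rowt)).
  by apply/measurable_EFinP; exact: continuous_measurable_rowt.
rewrite /integral_rV /Rintegral; congr fine.
rewrite [LHS]integralE [RHS]integralE; congr (_ - _)%E.
  rewrite -(ge0_integral_translate at_ (f := (EFin \o (g \o rowt))^\+%E)) //.
  - by apply: eq_integral => t _; rewrite !funeposE /= shE.
  - exact: measurable_funepos.
rewrite -(ge0_integral_translate at_ (f := (EFin \o (g \o rowt))^\-%E)) //.
- by apply: eq_integral => t _; rewrite !funenegE /= shE.
- exact: measurable_funeneg.
Qed.

Lemma cdominated : exists2 M : R, 0 <= M & forall B f,
  bnd 0 (- dimb) B f -> forall t, cmod (f (rowt t)) <= B * M * cauchy_density t.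
Proof.
have [M M0 HM] := growth_le_cauchy; exists M => // B f fB t.
apply: (le_trans (fB [::] isT _)); rewrite -mulrA.
by rewrite ler_wpM2l ?(bnd_ge0 fB) // HM.
Qed.

Lemma rapid_integrable f : rapid f ->
  mu.-integrable setT (EFin \o ((fun x => complex.Re (f x)) \o rowt)) /\
  mu.-integrable setT (EFin \o ((fun x => complex.Im (f x)) \o rowt)).
Proof.
move=> rf; have [c1 c2] := rapid_continuous rf.
have [B fB] := rf.2 0%N (- dimb); have [M _ HM] := cdominated.
split; apply: (@integrable_dominated _ (B * M)) => // t.
  exact: le_trans (Re_le_cmod _) (HM _ _ fB t).
exact: le_trans (Im_le_cmod _) (HM _ _ fB t).
Qed.

Lemma cintegralD f g : rapid f -> rapid g ->
  cintegral (fun x => f x + g x) = cintegral f + cintegral g.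
Proof.
move=> rf rg; have [f1 f2] := rapid_integrable rf.
have [g1 g2] := rapid_integrable rg.
apply: complexP; rewrite ?cReD ?cImD /= /integral_rV.
  by rewrite -RintegralD //; apply: eq_Rintegral => t _; rewrite cReD.
by rewrite -RintegralD //; apply: eq_Rintegral => t _; rewrite cImD.
Qed.

Lemma cintegralZ (c : C) f : rapid f ->
  cintegral (fun x => c * f x) = c * cintegral f.
Proof.
move=> rf; have [f1 f2] := rapid_integrable rf.
have Z (a : R) (g : V -> R) : mu.-integrable setT (EFin \o (g \o rowt)) ->
    mu.-integrable setT (EFin \o (fun t => a * g (rowt t))).
  by move=> ig; exact: (integrableZl measurableT a ig).
apply: complexP; rewrite ?cReM ?cImM /= /integral_rV -!RintegralZl //.
  rewrite -RintegralB //; [|exact: (Z _ _ f1)|exact: (Z _ _ f2)].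
  by apply: eq_Rintegral => t _; rewrite cReM.
rewrite -RintegralD //; [|exact: (Z _ _ f2)|exact: (Z _ _ f1)].
by apply: eq_Rintegral => t _; rewrite cImM.
Qed.

Lemma cintegral_translate f a : rapid f ->
  cintegral (fun x => f (x + a)) = cintegral f.
Proof.
move=> /rapid_continuous [c1 c2]; apply: complexP => /=.
  exact: (integral_translate a c1).
exact: (integral_translate a c2).
Qed.

Lemma cintegral_bound : exists2 M : R, 0 <= M & forall B f, rapid f ->
  bnd 0 (- dimb) B f -> cmod (cintegral f) <= M * B.
Proof.
have [M M0 HM] := cdominated.
have I0 : 0 <= \int[mu]_t cauchy_density t.
  by apply: Rintegral_ge0 => t _; exact: cauchy_density_ge0.
exists (2 * (M * \int[mu]_t cauchy_density t)) => [|B f rf fB].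
  by rewrite !mulr_ge0.
have [c1 c2] := rapid_continuous rf.
apply: (le_trans (cmod_le_ReIm _)) => /=.
rewrite -mulrA mulr_natl mulr2n [X in X + X]mulrC [X in X + X]mulrA.
apply: lerD; apply: integral_dominated => // t.
  exact: le_trans (Re_le_cmod _) (HM _ _ fB t).
exact: le_trans (Im_le_cmod _) (HM _ _ fB t).
Qed.

Lemma fourierE f eta : fourier f eta = cintegral (fun x => plane (- eta) x * f x).
Proof. by congr cintegral; apply/funext => x; rewrite /plane dotvNr. Qed.

Lemma fourierD f g : rapid f -> rapid g ->
  fourier (fun x => f x + g x) = fun eta => fourier f eta + fourier g eta.
Proof.
move=> rf rg; apply/funext => eta; rewrite !fourierE.
rewrite -cintegralD; [|exact: rapid_plane..].
by congr cintegral; apply/funext => x; rewrite mulrDr.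
Qed.

Lemma fourierZ (c : C) f : rapid f ->
  fourier (fun x => c * f x) = fun eta => c * fourier f eta.
Proof.
move=> rf; apply/funext => eta; rewrite !fourierE -cintegralZ; last exact: rapid_plane.
by congr cintegral; apply/funext => x; rewrite mulrCA.
Qed.

Lemma fourier_plane f xi : fourier (fun x => plane xi x * f x) =
  fun eta => fourier f (eta - xi).
Proof.
apply/funext => eta; rewrite !fourierE; congr cintegral; apply/funext => x.
by rewrite mulrA -cisD -dotvDr opprB addrC.
Qed.

Lemma fourier_translate f a : rapid f -> fourier (fun x => f (x + a)) =
  fun eta => plane a eta * fourier f eta.
Proof.
move=> rf; apply/funext => eta; rewrite !fourierE.
rewrite -(cintegral_translate a (rapid_plane hw (- eta) rf)) -cintegralZ; last first.
  exact: rapid_translate (rapid_plane hw (- eta) rf).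
congr cintegral; apply/funext => x; rewrite mulrA -cisD; congr (cis _ * _).
by rewrite dotvDl !dotvNr [dotv eta a]dotvC; ring.
Qed.

Lemma fourier_bound : exists2 M : R, 0 <= M & forall B f, rapid f ->
  (forall x, cmod (f x) <= B * growth w (- dimb) x) ->
  forall eta, cmod (fourier f eta) <= M * B.
Proof.
have [M M0 HM] := cintegral_bound; exists M => // B f rf fB eta.
rewrite fourierE; apply: HM; first exact: rapid_plane.
move=> s; rewrite leqn0 size_eq0 => /eqP -> x.
by rewrite partials0 cmodM cmod_plane mul1r.
Qed.

End Fourier.

(** * Derivatives, coordinates and remainders under the Fourier transform *)

Section FourierCalculus.
Variables (R : realType) (d : nat) (w : R -> R).
Hypothesis hw : weight w.
Local Notation V := 'rV[R]_d.
Local Notation C := R[i].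
Local Notation rapid := (@rapid R d w).
Local Notation bnd := (@bnd R d w).
Local Notation dimb := (@dimb R d).
Implicit Types (f g : V -> C) (x y v xi eta : V) (s : seq 'I_d) (j : 'I_d).
Implicit Types (l A B : R) (N : nat).

Lemma rapid0 : rapid (fun=> 0).
Proof.
split; first exact: smooth_cst.
move=> N l; exists 0 => s _ x; rewrite mul0r.
suff -> : partials s (fun _ : V => 0) = fun=> 0 :> C by rewrite cmod0.
by case: s => // j s; exact: partials_cst.
Qed.

Lemma fourier0 : fourier (fun _ : V => 0) = fun=> 0 :> C.
Proof.
have := fourierZ hw 0 rapid0.
under [X in fourier X]eq_fun do rewrite mul0r.
by move=> ->; apply/funext => eta; rewrite mul0r.
Qed.

Lemma rapid_sum (I : Type) (r : seq I) (F : I -> V -> C) :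
  (forall i, rapid (F i)) -> rapid (fun y => \sum_(i <- r) F i y).
Proof.
move=> rF; elim: r => [|i r IH].
  by under eq_fun do rewrite big_nil; exact: rapid0.
by under eq_fun do rewrite big_cons; exact: rapidD.
Qed.

Lemma fourier_sum (I : Type) (r : seq I) (F : I -> V -> C) :
  (forall i, rapid (F i)) -> fourier (fun y => \sum_(i <- r) F i y) =
  fun eta => \sum_(i <- r) fourier (F i) eta.
Proof.
move=> rF; elim: r => [|i r IH].
  under eq_fun do rewrite big_nil.
  by rewrite fourier0; apply/funext => eta; rewrite big_nil.
under eq_fun do rewrite big_cons.
rewrite (fourierD hw) //; last exact: rapid_sum.
by rewrite IH; apply/funext => eta; rewrite big_cons.
Qed.

Lemma rapidN f : rapid f -> rapid (fun y => - f y).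
Proof. by move=> rf; under eq_fun do rewrite -mulN1r; exact: rapidZ. Qed.

Lemma fourierN f : rapid f ->
  fourier (fun y => - f y) = fun eta => - fourier f eta.
Proof.
move=> rf; under eq_fun do rewrite -mulN1r.
by rewrite (fourierZ hw) //; apply/funext => eta; rewrite mulN1r.
Qed.

Lemma sqr_dotv_le y v : dotv y v ^+ 2 <= enorm y ^+ 2 * enorm v ^+ 2.
Proof.
rewrite -exprMn -real_normK ?num_real // ler_pXn2r ?nnegrE ?mulr_ge0 ?enorm_ge0 //.
rewrite ler_norml dotv_le_enorm andbT lerNl -dotvNl.
by rewrite -(enormN y) dotv_le_enorm.
Qed.

Lemma fourier_remainder f eta : rapid f -> exists B, forall v,
  cmod (fourier f (eta + v) + (- fourier f eta +
    \sum_j ('i * (v ord0 j)%:C) * fourier (fun y => coord j y * f y) eta))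
  <= B * `|v| ^+ 2.
Proof.
move=> rf; have [M M0 HM] := fourier_bound d hw.
have [K K1 HK] := enorm_le_growth d hw.
(* Two more units of decay than integrability requires pay for the square of |y|. *)
have [A fA] := rf.2 0%N (- dimb - 2).
exists (M * (2 * (d%:R ^+ 2 * (K ^+ 2 * A)))) => v.
pose S y := \sum_j ('i * (v ord0 j)%:C) * (coord j y * f y).
pose rem y := plane (- v) y * f y + (- f y + S y).
have rS : rapid S by apply: rapid_sum => j; apply: rapidZ; exact: rapid_coord.
have rP : rapid (fun y => plane (- v) y * f y) by exact: rapid_plane.
have rN : rapid (fun y => - f y + S y) by apply: rapidD => //; exact: rapidN.
have rrem : rapid rem by exact: rapidD.
have -> : fourier f (eta + v) + (- fourier f eta +
    \sum_j ('i * (v ord0 j)%:C) * fourier (fun y => coord j y * f y) eta) =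
    fourier rem eta.
  rewrite /rem (fourierD hw) // (fourierD hw) //; last exact: rapidN.
  rewrite fourier_plane opprK fourierN // fourier_sum; last first.
    by move=> j; apply: rapidZ; exact: rapid_coord.
  congr (_ + (_ + _)); apply: eq_bigr => j _.
  by rewrite (fourierZ hw) //; exact: rapid_coord.
rewrite -mulrA; apply: HM => // y.
have SE : S y = 'i * (dotv y v)%:C * f y.
  rewrite /S /dotv rmorph_sum mulr_sumr mulr_suml; apply: eq_bigr => j _.
  by rewrite /coord rmorphM; ring.
have -> : rem y = (cis (- dotv y v) - 1 - 'i * (- dotv y v)%:C) * f y.
  by rewrite /rem SE /plane dotvNr rmorphN; ring.
rewrite cmodM.
have KG := HK y; have e0 := enorm_ge0 y; have ev := enorm_le_mx_norm v.
have y2 : enorm y ^+ 2 <= K ^+ 2 * growth w 2 y.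
  have -> : growth w 2 y = growth w 1 y ^+ 2 by rewrite expr2 -growthM.
  rewrite -exprMn ler_pXn2r ?nnegrE //; first by rewrite (le_trans _ KG) // lerDr.
  by rewrite (le_trans _ KG) // addr_ge0.
have v2 : enorm v ^+ 2 <= d%:R ^+ 2 * `|v| ^+ 2.
  by rewrite -exprMn ler_pXn2r ?nnegrE ?enorm_ge0 // mulr_ge0.
have c2 : cmod (cis (- dotv y v) - 1 - 'i * (- dotv y v)%:C) <=
    2 * ((K ^+ 2 * growth w 2 y) * (d%:R ^+ 2 * `|v| ^+ 2)).
  apply: (le_trans (cis_taylor2 _)); rewrite ler_wpM2l // sqrrN.
  by apply: (le_trans (sqr_dotv_le _ _)); apply: ler_pM; rewrite ?sqr_ge0.
have := fA [::] isT y; rewrite partials0 => fy.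
apply: (le_trans (ler_pM (cmod_ge0 _) (cmod_ge0 _) c2 fy)).
rewrite le_eqVlt; apply/orP; left; apply/eqP.
have -> : growth w (- dimb) y = growth w 2 y * growth w (- dimb - 2) y.
  by rewrite -growthM; congr (growth w _ y); ring.
by ring.
Qed.

Lemma fourier_derivative f : rapid f -> (forall eta, cdiff (fourier f) eta) /\
  forall j, partial j (fourier f) =
    fun eta => - 'i * fourier (fun y => coord j y * f y) eta.
Proof.
move=> rf.
pose a eta j : C := - 'i * fourier (fun y => coord j y * f y) eta.
have Re0 : complex.Re (0 : C) = 0 by [].
have Im0 : complex.Im (0 : C) = 0 by [].
have key eta : [/\ differentiable (fun x => complex.Re (fourier f x)) eta,
    (forall v, 'D_v (fun x => complex.Re (fourier f x)) eta =
      dotv v (\row_j complex.Re (a eta j))),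
    differentiable (fun x => complex.Im (fourier f x)) eta &
    (forall v, 'D_v (fun x => complex.Im (fourier f x)) eta =
      dotv v (\row_j complex.Im (a eta j)))].
  have [B HB] := fourier_remainder eta rf.
  have [r1 r2] : differentiable (fun x => complex.Re (fourier f x)) eta /\
      forall v, 'D_v (fun x => complex.Re (fourier f x)) eta =
      dotv v (\row_j complex.Re (a eta j)).
    apply: (@quadratic_differentiable R d _ eta (\row_j complex.Re (a eta j)) B) => v.
    apply: le_trans (HB v); apply: le_trans (Re_le_cmod _).
    rewrite !cReD (big_morph _ (@cReD R) Re0) le_eqVlt; apply/orP; left; apply/eqP.
    congr `| _ |; rewrite -addrA; congr (_ + (_ + _)).
    rewrite -sumrN; apply: eq_bigr => j _; rewrite !mxE /a.
    by case: (fourier _ _) => p q /=; ring.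
  have [i1 i2] : differentiable (fun x => complex.Im (fourier f x)) eta /\
      forall v, 'D_v (fun x => complex.Im (fourier f x)) eta =
      dotv v (\row_j complex.Im (a eta j)).
    apply: (@quadratic_differentiable R d _ eta (\row_j complex.Im (a eta j)) B) => v.
    apply: le_trans (HB v); apply: le_trans (Im_le_cmod _).
    rewrite !cImD (big_morph _ (@cImD R) Im0) le_eqVlt; apply/orP; left; apply/eqP.
    congr `| _ |; rewrite -addrA; congr (_ + (_ + _)).
    rewrite -sumrN; apply: eq_bigr => j _; rewrite !mxE /a.
    by case: (fourier _ _) => p q /=; ring.
  by [].
split=> [eta|j]; first by have [h1 _ h2 _] := key eta.
apply/funext => eta; have [_ h1 _ h2] := key eta.
apply: complexP; rewrite /partial.
  by rewrite [LHS]h1 dotvC dotv_delta mxE.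
by rewrite [LHS]h2 dotvC dotv_delta mxE.
Qed.

Lemma smooth_fourier f : rapid f -> smooth (fourier f).
Proof.
move=> rf; apply/smoothE => n.
(* The statement is closed under derivatives only with a constant and a general [g]: differentiation
   produces [- 'i] and replaces [g] by [y_j g]. *)
suff H m c g : rapid g -> csmooth m (fun x => c * fourier g x).
  have := H n 1 f rf; rewrite (_ : (fun x => _) = fourier f) //.
  by apply/funext => x; exact: mul1r.
elim: m c g => [c g _ s x //|m IH c g rg].
have [gd gE] := fourier_derivative rg.
apply/csmoothS; split=> [x|j].
  by apply: cdiffM => //; exact: cdiff_cst.
rewrite partialZ // gE; under eq_fun do rewrite mulrA.
by apply: IH; exact: rapid_coord.
Qed.

Lemma fourier_coord j f : rapid f ->
  fourier (fun y => coord j y * f y) = fun eta => 'i * partial j (fourier f) eta.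
Proof.
move=> rf; have [_ ->] := fourier_derivative rf; apply/funext => eta.
by rewrite mulrA mulrN -expr2 sqr_i opprK mul1r.
Qed.

Lemma tremainderE j (h : R) f : tremainder j h f =
  fun y => f (y + h *: delta_mx ord0 j) + (- f y + - h%:C * partial j f y).
Proof. by []. Qed.

Lemma rapid_tremainder j (h : R) f : rapid f -> rapid (tremainder j h f).
Proof.
move=> rf; apply: rapidD; first exact: rapid_translate.
by apply: rapidD; [exact: rapidN|apply: rapidZ; exact: rapid_partial].
Qed.

(* Translation invariance replaces integration by parts: the Fourier transform
   of [tremainder j h f] is O(h^2). *)
Lemma fourier_partial j f : rapid f ->
  fourier (partial j f) = fun eta => 'i * (coord j eta * fourier f eta).
Proof.
move=> rf; apply/funext => eta.
have rj := rapid_partial j rf.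
have E h : fourier (tremainder j h f) eta =
    plane (h *: delta_mx ord0 j) eta * fourier f eta +
    (- fourier f eta + - h%:C * fourier (partial j f) eta).
  rewrite tremainderE (fourierD hw); first last.
  - by apply: rapidD; [exact: rapidN|exact: rapidZ].
  - exact: rapid_translate.
  rewrite (fourierD hw); first last.
  - exact: rapidZ.
  - exact: rapidN.
  by rewrite (fourier_translate hw) // fourierN // (fourierZ hw).
have [M M0 HM] := fourier_bound d hw.
have dimb0 : 0 <= dimb by rewrite mulr_ge0.
have [A fA] := rf.2 2%N (- dimb).
set F := fourier f eta; set D := fourier (partial j f) eta.
(* The first term bounds the transform of the translation remainder, the second the Taylor remainder
   of [plane (h e_j)] at [eta]; a factor [h^2] is divided out of both. *)
pose B := M * (2 * (expR (dimb * w 1) * A)) +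
  2 * (eta ord0 j ^+ 2 * cmod F).
apply/esym/eqP; rewrite -subr_eq0; apply/eqP/ComplexField.Normc.eq0_normc.
rewrite -/(cmod _); set c := cmod _; have c0 : 0 <= c by exact: cmod_ge0.
have cB h : 0 < h -> h <= 1 -> c <= h * B.
  move=> h0 h1; rewrite -(ler_pM2l h0).
  have hn : `|h| <= 1 by rewrite gtr0_norm.
  have -> : h * c = cmod (fourier (tremainder j h f) eta -
      (cis (h * eta ord0 j) - 1 - 'i * (h * eta ord0 j)%:C) * F).
    rewrite -[h in LHS]gtr0_norm // -cmod_real -cmodM E -/F -/D.
    rewrite /plane dotvZr dotv_delta /coord rmorphM; congr cmod.
    by ring.
  apply: (le_trans (cmodB _ _)); rewrite /B !mulrDr; apply: lerD.
    have [st bt] := rapid_tremainder j h rf.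
    have H := bnd_tremainder hw j rf.1 dimb0 hn fA.
    apply: le_trans (HM _ _ (rapid_tremainder j h rf) (H [::] isT) eta) _.
    by rewrite le_eqVlt; apply/orP; left; apply/eqP; ring.
  rewrite cmodM [leRHS](_ : _ = 2 * (h * eta ord0 j) ^+ 2 * cmod F); last by ring.
  by rewrite ler_wpM2r ?cmod_ge0 // cis_taylor2.
apply/eqP; rewrite eq_le c0 andbT leNgt; apply/negP => cp.
have B0 : 0 < 2 * (`|B| + 1) by rewrite mulr_gt0 // ltr_wpDl.
(* Chosen so that [h (|B| + 1) <= c / 2], which contradicts [c <= h B] when [c] is positive. *)
pose h := Num.min 1 (c / (2 * (`|B| + 1))).
have h0 : 0 < h by rewrite lt_min ltr01 divr_gt0.
have h1 : h <= 1 by rewrite ge_min lexx.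
have : c <= c / 2.
  apply: le_trans (cB h h0 h1) _.
  apply: (@le_trans _ _ (h * (`|B| + 1))).
    by rewrite ler_pM2l // (le_trans (ler_norm B)) // lerDl.
  rewrite -ler_pdivlMr ?ltr_wpDl // -mulrA -invfM mulrC.
  by rewrite ge_min mulrC [X in _ || X]lexx orbT.
by rewrite leNgt ltr_pdivrMr // ltr_pMr // ltr1n.
Qed.

Lemma fourier_tremainder j (h : R) f : rapid f ->
  fourier (tremainder j h f) = fun eta => mremainder j h eta * fourier f eta.
Proof.
move=> rf; apply/funext => eta; have rj := rapid_partial j rf.
rewrite tremainderE (fourierD hw); first last.
- by apply: rapidD; [exact: rapidN|exact: rapidZ].
- exact: rapid_translate.
rewrite (fourierD hw); first last.
- exact: rapidZ.
- exact: rapidN.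
rewrite (fourier_translate hw) // fourierN // (fourierZ hw) // fourier_partial //.
by rewrite /mremainder; ring.
Qed.

Lemma fourier_mremainder j (h : R) f : rapid f ->
  fourier (fun y => mremainder j h y * f y) = tremainder j (- h) (fourier f).
Proof.
move=> rf; apply/funext => eta; have rj := rapid_coord hw j rf.
have -> : (fun y => mremainder j h y * f y) = fun y =>
    plane (h *: delta_mx ord0 j) y * f y +
    (- f y + - ('i * h%:C) * (coord j y * f y)).
  by apply/funext => y; rewrite /mremainder; ring.
rewrite (fourierD hw); first last.
- by apply: rapidD; [exact: rapidN|exact: rapidZ].
- exact: rapid_plane.
rewrite (fourierD hw); first last.
- exact: rapidZ.
- exact: rapidN.
rewrite fourier_plane fourierN // (fourierZ hw) // fourier_coord //.
rewrite /tremainder scaleNr rmorphN; congr (_ + (_ + _)).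
rewrite mulNr mulrACA -expr2 sqr_i; ring.
Qed.

End FourierCalculus.

(** * The space S_w *)

Section BiRapid.
Variables (R : realType) (d : nat) (w : R -> R).
Hypothesis hw : weight w.
Local Notation V := 'rV[R]_d.
Local Notation C := R[i].
Local Notation rapid := (@rapid R d w).
Local Notation bnd := (@bnd R d w).
Implicit Types (f g : V -> C) (x y v xi eta : V) (s : seq 'I_d) (j : 'I_d).
Implicit Types (l A B : R) (N : nat) (a b : multi_index d).

(* A description of [Sw] that is visibly invariant under the Fourier transform
   and under permutation of the axes in iterated partial derivatives. *)
Definition birapid f := rapid f /\ rapid (fourier f).

Lemma birapid0 : birapid (fun=> 0).
Proof. by split; [exact: rapid0|rewrite (fourier0 d hw); exact: rapid0]. Qed.

Lemma birapidD f g : birapid f -> birapid g -> birapid (fun y => f y + g y).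
Proof.
move=> [f1 f2] [g1 g2]; split; first exact: rapidD.
by rewrite (fourierD hw) //; exact: rapidD.
Qed.

Lemma birapidZ (c : C) f : birapid f -> birapid (fun y => c * f y).
Proof.
move=> [f1 f2]; split; first exact: rapidZ.
by rewrite (fourierZ hw) //; exact: rapidZ.
Qed.

Lemma birapid_coord j f : birapid f -> birapid (fun y => coord j y * f y).
Proof.
move=> [f1 f2]; split; first exact: rapid_coord.
by rewrite (fourier_coord hw) //; apply: rapidZ; exact: rapid_partial.
Qed.

Lemma birapid_partial j f : birapid f -> birapid (partial j f).
Proof.
move=> [f1 f2]; split; first exact: rapid_partial.
by rewrite (fourier_partial hw) //; apply: rapidZ; exact: rapid_coord.
Qed.

Lemma birapid_translate v f : birapid f -> birapid (fun y => f (y + v)).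
Proof.
move=> [f1 f2]; split; first exact: rapid_translate.
by rewrite (fourier_translate hw) //; exact: rapid_plane.
Qed.

Lemma birapid_plane xi f : birapid f -> birapid (fun y => plane xi y * f y).
Proof.
move=> [f1 f2]; split; first exact: rapid_plane.
by rewrite fourier_plane; exact: rapid_translate.
Qed.

Lemma birapid_tremainder j (h : R) f : birapid f -> birapid (tremainder j h f).
Proof.
move=> bf; apply: birapidD; first exact: birapid_translate.
apply: birapidD; last by apply: birapidZ; exact: birapid_partial.
by under eq_fun do rewrite -mulN1r; exact: birapidZ.
Qed.

Lemma birapid_mremainder j (h : R) f : `|h| <= 1 -> birapid f ->
  birapid (fun y => mremainder j h y * f y).
Proof.
move=> h1 [f1 f2]; split; first exact: rapid_mremainder.
by rewrite (fourier_mremainder hw) //; exact: rapid_tremainder.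
Qed.

Definition word a : seq 'I_d := flatten [seq nseq (a j) j | j <- enum 'I_d].

Lemma count_word a i : count_mem i (word a) = a i.
Proof.
rewrite count_flatten -map_comp sumnE big_map big_enum /= (bigD1 i) //=.
rewrite count_nseq /= eqxx mul1n big1 ?addn0 // => j ji.
by rewrite count_nseq /= (negbTE ji).
Qed.

Definition counts s : multi_index d := [ffun j => count_mem j s].

Lemma perm_word s : perm_eq (word (counts s)) s.
Proof. by apply/allP => i _ /=; rewrite count_word ffunE. Qed.

Lemma DopE a f x : Dop a f x = (0 -i* 1) ^+ mlength a * partials (word a) f x.
Proof. by []. Qed.

Lemma cmod_Dop a f x : cmod (Dop a f x) = cmod (partials (word a) f x).
Proof.
rewrite DopE cmodM cmodX (_ : cmod _ = 1) ?expr1n ?mul1r //.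
by rewrite /cmod /= expr0n sqrrN expr1n add0r sqrtr1.
Qed.

(* The operators [Dop] see only words sorted by the axes; the symmetry of mixed
   partial derivatives gives all the others. *)
Lemma rapidP f : smooth f ->
  (forall l a, 0 < l -> has_ubound (direct_vals w l a f)) -> rapid f.
Proof.
move=> sf H; split=> // N l.
have one s : exists B, forall x, cmod (partials s f x) <= B * growth w l x.
  (* The seminorms have positive exponents; |l| + 1 is positive and its opposite is at most [l]. *)
  have l1 : 0 < `|l| + 1 by rewrite ltr_wpDl.
  have [B HB] := H (`|l| + 1) (counts s) l1; exists B => x.
  have HBx : growth w (`|l| + 1) x * cmod (Dop (counts s) f x) <= B.
    by apply: HB; exists x.
  rewrite cmod_Dop (partials_perm sf (perm_word s)) in HBx.
  have B0 : 0 <= B by rewrite (le_trans _ HBx) // mulr_ge0 ?growth_ge0 ?cmod_ge0.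
  apply: (@le_trans _ _ (B * growth w (- (`|l| + 1)) x)).
    rewrite -ler_pdivrMr ?growth_gt0 // (_ : _^-1 = growth w (`|l| + 1) x).
      by rewrite mulrC.
    by apply: (mulIf (lt0r_neq0 (growth_gt0 w (- (`|l| + 1)) x)));
      rewrite mulVf ?gt_eqF ?growth_gt0 // growthN.
  apply: ler_wpM2l => //; apply: ler_growth => //.
  by rewrite lerNl ler_wpDr // -normrN ler_norm.
(* One bound per word becomes a bound uniform over words of length at most [N]: there are finitely
   many axes, so the constants for the innermost derivatives can be summed. *)
elim: N f sf {H} one => [|N IH] f sf one.
  have [B HB] := one [::]; exists B => s; rewrite leqn0 size_eq0 => /eqP ->.
  exact: HB.
have [B0 HB0] := one [::].
have Bj j : exists B, bnd N l B (partial j f).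
  apply: IH; first exact: smooth_partial.
  by move=> s; have [B HB] := one (rcons s j); exists B => x; rewrite -partials_rcons.
have [B HB] := choice Bj.
exists (`|B0| + \sum_j `|B j|) => s.
have S0 : 0 <= \sum_j `|B j| by exact: sumr_ge0.
case/lastP: s => [_ x|s j].
  apply: (le_trans (HB0 x)); rewrite ler_wpM2r ?growth_ge0 //.
  by rewrite (le_trans (ler_norm _)) // lerDl.
rewrite size_rcons ltnS partials_rcons => sN x.
apply: (le_trans (HB j s sN x)).
rewrite ler_wpM2r ?growth_ge0 // (le_trans (ler_norm _)) //.
rewrite (bigD1 j) //= addrCA lerDl addr_ge0 //.
exact: sumr_ge0.
Qed.

Lemma rapid_bounded l a f : rapid f -> has_ubound (direct_vals w l a f).
Proof.
move=> [sf rf]; have [B HB] := rf (size (word a)) (- l); exists B => _ [x _ <-].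
rewrite cmod_Dop (le_trans (ler_wpM2l (growth_ge0 _ _ _) (HB _ (leqnn _) x))) //.
by rewrite mulrCA growthN mulr1.
Qed.

(** The Schwartz bounds come for free from [rapid], since each coordinate factor of a monomial is
    absorbed by one unit of growth. Conversely [rapidP] is applied to [f] and to its transform. *)
Lemma birapid_Sw f : Sw w f <-> birapid f.
Proof.
split=> [[[sf _] H]|[rf rF]].
  have rf : rapid f by apply: rapidP => // l a l0; have [] := H l a l0.
  split=> //; apply: rapidP; first exact: (smooth_fourier hw).
  by move=> l a l0; have [] := H l a l0.
split; last first.
  by move=> l a _; split; [exact: rapid_bounded|exact: (rapid_bounded l a rF)].
split; first by case: rf.
move=> a b; have [K K1 HK] := enorm_le_growth d hw.
have K0 : 0 <= K by exact: le_trans ler01 K1.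
pose n := (\sum_i a i)%N.
have [B HB] := rf.2 (size (word b)) (- n%:R).
exists (K ^+ n * B) => _ [x _ <-]; rewrite cmodM cmod_Dop.
have mx : cmod (mono a x) <= K ^+ n * growth w n%:R x.
  rewrite /mono cmod_real normr_prod -[n%:R]mulr1 growthX -exprMn /n -prodrXr.
  apply: ler_prod => i _; rewrite normr_ge0 normrX lerXn2r ?nnegrE //.
    by rewrite mulr_ge0 ?growth_ge0.
  by rewrite (le_trans (coord_le_enorm x i)) // (le_trans _ (HK x)) // lerDr.
apply: (le_trans (ler_pM (cmod_ge0 _) (cmod_ge0 _) mx (HB _ (leqnn _) x))).
by rewrite mulrACA growthN mulr1.
Qed.

End BiRapid.

(** * Tempered functionals *)

Section TemperedFunctionals.
Variables (R : realType) (d : nat) (w : R -> R).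
Hypothesis hw : weight w.
Local Notation V := 'rV[R]_d.
Local Notation C := R[i].
Local Notation rapid := (@rapid R d w).
Local Notation birapid := (@birapid R d w).
Local Notation bnd := (@bnd R d w).
Implicit Types (f g : V -> C) (x y v xi eta : V) (s : seq 'I_d) (j : 'I_d).
Implicit Types (l A B L M h : R) (N : nat) (a b : multi_index d).
Implicit Types (u : (V -> C) -> C) (z : 'rV[R]_(d + d)).

(** Continuity as one explicit estimate, a form that passes to compositions with [x_j] and [d_j].
    Strict positivity of [B] permits rescaling by its inverse. *)
Definition tempered u :=
  (forall (c : C) f g, birapid f -> birapid g ->
    u (fun x => c * f x + g x) = conjc c * u f + u g) /\
  exists N L M, [/\ 0 <= L, 0 <= M & forall g B, birapid g -> 0 < B ->
    bnd N (- L) B g -> bnd N (- L) B (fourier g) -> cmod (u g) <= M * B].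

Lemma conj_linear0 u : (forall (c : C) f g, birapid f -> birapid g ->
    u (fun x => c * f x + g x) = conjc c * u f + u g) -> u (fun=> 0) = 0.
Proof.
move=> ul; have := ul 1 _ _ (birapid0 d hw) (birapid0 d hw).
have -> : (fun x : V => 1 * (fun=> 0) x + (fun=> 0) x) = fun=> 0 :> C.
  by apply/funext => x; rewrite mul1r addr0.
rewrite conjc1 mul1r.
by move/eqP; rewrite -subr_eq subrr eq_sym => /eqP.
Qed.

(** Continuity at 0 with tolerance 1 yields a seminorm ball of radius [r]; scaling [g] into it and
    using homogeneity gives the constant [2 / r]. *)
Lemma Sw_dual_tempered u : Sw_dual w u -> tempered u.
Proof.
move=> [ul uc]; have ul' (c : C) f g : birapid f -> birapid g ->
    u (fun x => c * f x + g x) = conjc c * u f + u g.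
  by move=> /birapid_Sw sf /birapid_Sw sg; apply: ul; [exact: sf|exact: sg].
split=> //; have u0 := conj_linear0 ul'.
have S0 : Sw w (fun _ : V => 0 : C) by apply/(birapid_Sw hw); exact: birapid0.
have [J [r [J0 r0 HJ]]] := uc _ S0 1 ltr01.
(* Sums over the finite list [J] stand in for maxima. *)
pose N := (\sum_(p <- J) size (word p.2))%N.
pose L : R := \sum_(p <- J) `|p.1|.
have JN p : p \in J -> (size (word p.2) <= N)%N.
  by move=> pJ; rewrite /N (big_rem p) //= leq_addr.
have JL p : p \in J -> p.1 <= L.
  move=> pJ; rewrite /L (big_rem p) //= (le_trans (ler_norm _)) // lerDl.
  exact: sumr_ge0.
exists N, L, (2 / r); split; first exact: sumr_ge0.
  by rewrite divr_ge0 // ltW.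
move=> g B bg B0 gB FB.
(* Rescaling turns the bound [B] into [r / 2], strictly below [r]. *)
pose c := r / (2 * B); have c0 : 0 < c by rewrite divr_gt0 // mulr_gt0.
have bcg : birapid (fun x => c%:C * g x) by exact: birapidZ.
have vals f l a : bnd N (- L) B f -> (size (word a) <= N)%N -> l <= L ->
    smooth f -> sup (direct_vals w l a (fun x => c%:C * f x)) < r.
  move=> fB aN lL sf; apply: (@le_lt_trans _ _ (c * B)); last first.
    rewrite /c invfM mulrA mulfVK ?gt_eqF // ltr_pdivrMr // ltr_pMr //.
    by rewrite ltr1n.
  apply: ge_sup; first by eexists; exists (0 : V).
  move=> _ [x _ <-]; rewrite cmod_Dop partialsZ // cmodM cmod_real gtr0_norm //.
  rewrite mulrCA ler_pM2l //.
  apply: le_trans (ler_wpM2l (growth_ge0 _ _ _) (fB _ aN x)) _.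
  rewrite mulrCA ler_piMr ?(ltW B0) //.
  rewrite -(growthN w L x) ler_wpM2r ?growth_ge0 //.
  exact: ler_growth.
have : cmod (u (fun x => c%:C * g x) - u (fun=> 0)) < 1.
  apply: HJ; first by apply/birapid_Sw.
  move=> p pJ.
  have -> : (fun x => c%:C * g x - 0) = (fun x => c%:C * g x).
    by apply/funext => x; rewrite subr0.
  split; first by apply: vals; rewrite ?JN ?JL //; exact: bg.1.1.
  rewrite /fourier_vals (fourierZ hw _ bg.1).
  by apply: vals; rewrite ?JN ?JL //; exact: bg.2.1.
have uZ : u (fun x => c%:C * g x) = conjc c%:C * u g.
  have := ul' c%:C _ _ bg (birapid0 d hw).
  rewrite u0 addr0 => <-; congr u; apply/funext => x; by rewrite addr0.
rewrite u0 subr0 uZ cmodM cmod_conjc cmod_real gtr0_norm // => /ltW.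
rewrite -ler_pdivlMl // mulr1 /c invf_div => H; apply: (le_trans H).
by rewrite mulrAC.
Qed.

Section Linear.
Variable u : (V -> C) -> C.
Hypothesis tu : tempered u.

Lemma tempered0 : u (fun=> 0) = 0.
Proof. exact: conj_linear0 tu.1. Qed.

Lemma temperedZ (c : C) f : birapid f -> u (fun x => c * f x) = conjc c * u f.
Proof.
move=> bf; have := tu.1 c _ _ bf (birapid0 d hw); rewrite tempered0 addr0 => <-.
by congr u; apply/funext => x; rewrite addr0.
Qed.

Lemma temperedD f g : birapid f -> birapid g ->
  u (fun x => f x + g x) = u f + u g.
Proof.
move=> bf bg; have := tu.1 1 _ _ bf bg; rewrite conjc1 mul1r => <-.
by congr u; apply/funext => x; rewrite mul1r.
Qed.

(** Multiplication by [x_j] costs one unit of decay on [g] and, becoming [i d_j], one derivative on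
    its transform; in [tempered_partial] the two sides are exchanged. *)
Lemma tempered_coord j : tempered (fun f => u (fun y => coord j y * f y)).
Proof.
split=> [c f g bf bg|].
  have bjf := birapid_coord hw j bf; have bjg := birapid_coord hw j bg.
  rewrite -tu.1 //; congr u; apply/funext => x; by ring.
have [N [L [M [L0 M0 HM]]]] := tu.2.
have [K K1 HK] := bnd_coord d hw.
have K2 : 1 <= 2 ^+ N * K by rewrite mulr_ege1 // exprn_ege1 // ler1n.
exists N.+1, (L + 1), (M * (2 ^+ N * K)); split.
- by rewrite addr_ge0.
- by rewrite mulr_ge0 // (le_trans ler01).
move=> g B bg B0 gB FB; rewrite -mulrA; apply: HM.
- exact: birapid_coord.
- by rewrite mulr_gt0 // (lt_le_trans ltr01).
- have gB' := bnd_le hw (leqnSn N) (lexx _) (lexx _) gB.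
  have := bndM hw (smooth_coord j) bg.1.1 (HK N j) gB'.
  by rewrite (_ : 1 - (L + 1) = - L) //; ring.
- rewrite (fourier_coord hw _ bg.1).
  have := bndZ 'i (smooth_partial j bg.2.1) (bnd_partial j FB).
  rewrite cmod_i mul1r; apply: bnd_le => //; first by rewrite lerN2 lerDl.
  by rewrite ler_peMl // ltW.
Qed.

Lemma tempered_partial j : tempered (fun f => u (partial j f)).
Proof.
split=> [c f g bf bg|].
  have bjf := birapid_partial hw j bf; have bjg := birapid_partial hw j bg.
  rewrite -tu.1 //; congr u; apply/funext => x.
  rewrite partialD; [|by apply: cdiffM; [exact: cdiff_cst|exact: (bf.1.1 [::])]|
    exact: (bg.1.1 [::])].
  by rewrite partialZ // => y; exact: (bf.1.1 [::]).
have [N [L [M [L0 M0 HM]]]] := tu.2.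
have [K K1 HK] := bnd_coord d hw.
have K2 : 1 <= 2 ^+ N * K by rewrite mulr_ege1 // exprn_ege1 // ler1n.
exists N.+1, (L + 1), (M * (2 ^+ N * K)); split.
- by rewrite addr_ge0.
- by rewrite mulr_ge0 // (le_trans ler01).
move=> g B bg B0 gB FB; rewrite -mulrA; apply: HM.
- exact: birapid_partial.
- by rewrite mulr_gt0 // (lt_le_trans ltr01).
- apply: (bnd_le hw _ _ _ (bnd_partial j gB)) => //; first by rewrite lerN2 lerDl.
  by rewrite ler_peMl // ltW.
- rewrite (fourier_partial hw _ bg.1).
  have FB' := bnd_le hw (leqnSn N) (lexx _) (lexx _) FB.
  have sc : smooth (fun eta => coord j eta * fourier g eta).
    by apply: smoothM; [exact: smooth_coord|exact: bg.2.1].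
  have := bndZ 'i sc (bndM hw (smooth_coord j) bg.2.1 (HK N j) FB').
  by rewrite cmod_i mul1r (_ : 1 - (L + 1) = - L) //; ring.
Qed.

(* The second-order remainders of modulation and translation, and their
   Fourier transforms, are O(h^2), so [u] of the infinitesimal generator is a
   difference quotient of [u] up to O(h). *)
Lemma modulation_quotient j : exists N L M, [/\ 0 <= L, 0 <= M &
  forall g B h, birapid g -> 0 < B -> 0 < h -> h <= 1 ->
    bnd N (- L) B g -> bnd N (- L) B (fourier g) ->
    h * cmod (u (fun y => coord j y * g y)) <=
    cmod (u (fun y => plane (h *: delta_mx ord0 j) y * g y)) + cmod (u g) +
    M * h ^+ 2 * B].
Proof.
have [N [L [M [L0 M0 HM]]]] := tu.2.
have [K K0 HK] := bnd_mremainder d hw.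
have L2 : 0 <= L + 2 by rewrite addr_ge0.
pose E := expR ((L + 2) * w 1); have E0 : 0 < E by exact: expR_gt0.
(* The first summand bounds the multiplication by [mremainder], which costs two units of decay; the
   second bounds the translation remainder of the transform, which costs two derivatives. *)
pose Q := 2 ^+ N * K + 2 * E.
have Q0 : 0 < Q by rewrite ltr_wpDl ?mulr_gt0 // mulr_ge0 // exprn_ge0.
exists N.+2, (L + 2), (M * Q); split=> //; first by rewrite mulr_ge0 // ltW.
move=> g B h bg B0 h0 h1 gB FB.
have hn : `|h| <= 1 by rewrite gtr0_norm.
have bp := birapid_plane hw (h *: delta_mx ord0 j) bg.
have bc := birapid_coord hw j bg.
have bN : birapid (fun y => -1 * g y) by exact: birapidZ.
have bC : birapid (fun y => - ('i * h%:C) * (coord j y * g y)) by exact: birapidZ.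
have uE : u (fun y => mremainder j h y * g y) =
    u (fun y => plane (h *: delta_mx ord0 j) y * g y) +
    (conjc (-1) * u g + conjc (- ('i * h%:C)) * u (fun y => coord j y * g y)).
  rewrite -temperedZ // -temperedZ // -temperedD // -temperedD //.
    by congr u; apply/funext => y; rewrite /mremainder; ring.
  exact: birapidD.
have h2 : 0 < h ^+ 2 by rewrite exprn_gt0.
have R1 : cmod (u (fun y => mremainder j h y * g y)) <= M * (Q * h ^+ 2 * B).
  apply: HM.
  - exact: birapid_mremainder.
  - by rewrite !mulr_gt0.
  - have gB' : bnd N (- (L + 2)) B g.
      exact: (bnd_le hw (leqW (leqnSn N)) (lexx _) (lexx _) gB).
    have := bndM hw (smooth_mremainder j h) bg.1.1 (HK N j h hn) gB'.
    rewrite (_ : 2 - (L + 2) = - L); last by ring.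
    apply: bnd_le => //; rewrite ler_wpM2r ?(ltW B0) // mulrA.
    by rewrite ler_wpM2r ?(ltW h2) // lerDl mulr_ge0 // ltW.
  - rewrite (fourier_mremainder hw _ _ bg.1).
    have hN : `|- h| <= 1 by rewrite normrN.
    have := bnd_tremainder hw j bg.2.1 L2 hN FB.
    apply: bnd_le => //; first by rewrite lerN2 lerDl.
    rewrite sqrrN mulrA ler_wpM2r ?(ltW B0) // -/E mulrAC.
    by rewrite ler_wpM2r ?(ltW h2) // lerDr mulr_ge0 // exprn_ge0.
have -> : h * cmod (u (fun y => coord j y * g y)) =
    cmod (conjc (- ('i * h%:C)) * u (fun y => coord j y * g y)).
  by rewrite cmodM cmod_conjc cmodN cmodM cmod_i cmod_real gtr0_norm // mul1r.
rewrite (_ : conjc (- _) * _ = u (fun y => mremainder j h y * g y) -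
  u (fun y => plane (h *: delta_mx ord0 j) y * g y) - conjc (-1) * u g); last first.
  by rewrite uE; ring.
have c1 : cmod (conjc (-1 : C)) = 1.
  by rewrite cmod_conjc cmodN -cmod_i /cmod /= addrC.
apply: (le_trans (cmodB _ _)); rewrite cmodM c1 mul1r.
apply: (le_trans (lerD (cmodB _ _) (lexx _))).
rewrite -addrA addrC lerD2l (le_trans R1) // le_eqVlt.
by apply/orP; left; apply/eqP; ring.
Qed.

(** Mirror image of [modulation_quotient]: the translation estimate applies to [g] and the
    multiplication estimate to its transform. *)
Lemma translation_quotient j : exists N L M, [/\ 0 <= L, 0 <= M &
  forall g B h, birapid g -> 0 < B -> 0 < h -> h <= 1 ->
    bnd N (- L) B g -> bnd N (- L) B (fourier g) ->
    h * cmod (u (partial j g)) <=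
    cmod (u (fun y => g (y + h *: delta_mx ord0 j))) + cmod (u g) +
    M * h ^+ 2 * B].
Proof.
have [N [L [M [L0 M0 HM]]]] := tu.2.
have [K K0 HK] := bnd_mremainder d hw.
have L2 : 0 <= L + 2 by rewrite addr_ge0.
pose E := expR ((L + 2) * w 1); have E0 : 0 < E by exact: expR_gt0.
pose Q := 2 ^+ N * K + 2 * E.
have Q0 : 0 < Q by rewrite ltr_wpDl ?mulr_gt0 // mulr_ge0 // exprn_ge0.
exists N.+2, (L + 2), (M * Q); split=> //; first by rewrite mulr_ge0 // ltW.
move=> g B h bg B0 h0 h1 gB FB.
have hn : `|h| <= 1 by rewrite gtr0_norm.
have bp := birapid_translate hw (h *: delta_mx ord0 j) bg.
have bc := birapid_partial hw j bg.
have bN : birapid (fun y => -1 * g y) by exact: birapidZ.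
have bC : birapid (fun y => - h%:C * partial j g y) by exact: birapidZ.
have uE : u (tremainder j h g) =
    u (fun y => g (y + h *: delta_mx ord0 j)) +
    (conjc (-1) * u g + conjc (- h%:C) * u (partial j g)).
  rewrite -temperedZ // -temperedZ // -temperedD // -temperedD //.
    by congr u; apply/funext => y; rewrite /tremainder; ring.
  exact: birapidD.
have h2 : 0 < h ^+ 2 by rewrite exprn_gt0.
have R1 : cmod (u (tremainder j h g)) <= M * (Q * h ^+ 2 * B).
  apply: HM.
  - exact: birapid_tremainder.
  - by rewrite !mulr_gt0.
  - have := bnd_tremainder hw j bg.1.1 L2 hn gB.
    apply: bnd_le => //; first by rewrite lerN2 lerDl.
    rewrite mulrA ler_wpM2r ?(ltW B0) // -/E mulrAC.
    by rewrite ler_wpM2r ?(ltW h2) // lerDr mulr_ge0 // exprn_ge0.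
  - rewrite (fourier_tremainder hw _ _ bg.1).
    have FB' : bnd N (- (L + 2)) B (fourier g).
      exact: (bnd_le hw (leqW (leqnSn N)) (lexx _) (lexx _) FB).
    have := bndM hw (smooth_mremainder j h) bg.2.1 (HK N j h hn) FB'.
    rewrite (_ : 2 - (L + 2) = - L); last by ring.
    apply: bnd_le => //; rewrite ler_wpM2r ?(ltW B0) // mulrA.
    by rewrite ler_wpM2r ?(ltW h2) // lerDl mulr_ge0 // ltW.
have -> : h * cmod (u (partial j g)) =
    cmod (conjc (- h%:C) * u (partial j g)).
  by rewrite cmodM cmod_conjc cmodN cmod_real gtr0_norm.
rewrite (_ : conjc (- _) * _ = u (tremainder j h g) -
  u (fun y => g (y + h *: delta_mx ord0 j)) - conjc (-1) * u g); last first.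
  by rewrite uE; ring.
have c1 : cmod (conjc (-1 : C)) = 1.
  by rewrite cmod_conjc cmodN -cmod_i /cmod /= addrC.
apply: (le_trans (cmodB _ _)); rewrite cmodM c1 mul1r.
apply: (le_trans (lerD (cmodB _ _) (lexx _))).
rewrite -addrA addrC lerD2l (le_trans R1) // le_eqVlt.
by apply/orP; left; apply/eqP; ring.
Qed.

End Linear.

End TemperedFunctionals.

(** * Propagation of microlocal regularity *)

Section Cones.
Variables (R : realType) (n : nat).
Implicit Types (z v : 'rV[R]_n).

Lemma mx_norm_le_enorm v : `|v| <= enorm v.
Proof.
rewrite {1}/Num.norm /= mx_normrE; apply: bigmax_le => [|[i j] _ /=].
  exact: enorm_ge0.
by rewrite (ord1 i) coord_le_enorm.
Qed.

(* A narrower cone whose unit neighbourhood lies, far from the origin, in the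
   given one. *)
Lemma open_conic_shrink (G : set 'rV[R]_n) z0 : open G -> conic G -> ~ G 0 ->
  G z0 -> exists (H : set 'rV[R]_n) (r : R), [/\ open H, conic H, ~ H 0, H z0 &
    forall z v, H z -> r <= enorm z -> enorm v <= 1 -> G (z + v)].
Proof.
move=> oG cG G0 Gz0.
have [e2 /= e20 eG] : exists2 e : R, 0 < e & ball z0 e `<=` G.
  by apply/nbhs_ballP; exact: oG.
(* [H] is spanned by the ball of half the radius; the other half absorbs the perturbation. *)
pose e := e2 / 2; have e0 : 0 < e by rewrite divr_gt0.
pose H : set 'rV[R]_n :=
  \bigcup_(t in [set t : R | 0 < t]) [set z | ball z0 e (t *: z)].
(* [M] bounds the Euclidean norm on the ball. If [t z] lies in it and |z| >= M / e, then [t <= e],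
   so [t v] has norm at most [e]. *)
pose M := n%:R * (`|z0| + e) + 1.
have M0 : 0 < M by rewrite ltr_wpDl // mulr_ge0 // addr_ge0 // ltW.
have be2 z v : ball z0 e z -> `|v| <= e -> G (z + v).
  rewrite -ball_normE /ball_ /= => ze ve; apply: eG.
  rewrite -ball_normE /ball_ /= opprD addrA (le_lt_trans (ler_normB _ _)) //.
  by rewrite [e2](_ : _ = e + e) ?ltr_leD // /e -splitr.
exists H, (M / e); split.
- apply: bigcup_open => t _.
  apply: (@open_comp _ _ (fun z => t *: z) (ball z0 e)).
    by move=> z _; exact: scaler_continuous.
  exact: ball_open.
- move=> t z t0 [s s0 sz]; exists (s / t); first by rewrite /= divr_gt0.
  by rewrite /= scalerA mulfVK ?gt_eqF.
- move=> [t t0 /= tz]; apply: G0; rewrite -(addr0 0) -{1}(scaler0 _ t).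
  by apply: be2 => //; rewrite normr0 ltW.
- by exists 1 => //=; rewrite scale1r; exact: ballxx.
move=> z v [t t0 /= tz] rz v1.
have tn : enorm (t *: z) <= M.
  apply: (le_trans (enorm_le_mx_norm _)); rewrite /M ler_wpDr //.
  apply: ler_wpM2l => //; have := tz; rewrite -ball_normE /ball_ /= distrC => tz'.
  rewrite -(subrK z0 (t *: z)) addrC (le_trans (ler_normD _ _)) // lerD2l.
  exact: ltW.
have te : t <= e.
  rewrite enormZ gtr0_norm // in tn.
  have := le_trans (ler_wpM2l (ltW t0) rz) tn.
  by rewrite mulrCA ger_pMr // ler_pdivrMr // mul1r.
have -> : z + v = t^-1 *: (t *: z + t *: v).
  by rewrite -scalerDr scalerA mulVf ?gt_eqF // scale1r.
apply: cG; first by rewrite invr_gt0.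
apply: be2 => //; rewrite normrZ gtr0_norm //.
apply: (@le_trans _ _ (t * 1)); last by rewrite mulr1.
by rewrite ler_pM2l // (le_trans (mx_norm_le_enorm _)).
Qed.

End Cones.

(** * Time-frequency shifts of the window and decay in cones *)

Section Microlocal.
Variables (R : realType) (d : nat) (w : R -> R) (phi : 'rV[R]_d -> R[i]).
Hypothesis hw : weight w.
Hypothesis bphi : birapid w phi.
Local Notation V := 'rV[R]_d.
Local Notation C := R[i].
Local Notation rapid := (@rapid R d w).
Local Notation birapid := (@birapid R d w).
Local Notation bnd := (@bnd R d w).
Local Notation tempered := (@tempered R d w).
Implicit Types (f g : V -> C) (x xi eta : V) (s : seq 'I_d) (j : 'I_d).
Implicit Types (l A B L M h r : R) (N : nat) (a b : multi_index d).
Implicit Types (u v : (V -> C) -> C) (z : 'rV[R]_(d + d)).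

Lemma tfshiftE z f : tfshift z f =
  fun y => plane (rsubmx z) y * f (y + - lsubmx z).
Proof. by []. Qed.

Lemma birapid_tfshift z : birapid (tfshift z phi).
Proof.
by rewrite tfshiftE; apply: birapid_plane => //; exact: birapid_translate.
Qed.

(** Up to a phase, the transform of a time-frequency shift is again one, with position and frequency
    exchanged up to sign. *)
Lemma fourier_tfshift z : fourier (tfshift z phi) = fun eta =>
  plane (- lsubmx z) (eta + - rsubmx z) * fourier phi (eta + - rsubmx z).
Proof.
by rewrite tfshiftE fourier_plane (fourier_translate hw) //; exact: bphi.1.
Qed.

Lemma dotv_split z : dotv z z =
  dotv (lsubmx z) (lsubmx z) + dotv (rsubmx z) (rsubmx z).
Proof.
rewrite /dotv big_split_ord.
by congr (_ + _); apply: eq_bigr => i _; rewrite !mxE.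
Qed.

Lemma growth_lsubmx l z : 0 <= l -> growth w l (lsubmx z) <= growth w l z.
Proof.
move=> l0; rewrite ler_expR ler_wpM2l //.
apply: (weight_homo hw); first exact: enorm_ge0.
by rewrite ler_wsqrtr // dotv_split lerDl dotv_ge0.
Qed.

Lemma growth_rsubmx l z : 0 <= l -> growth w l (rsubmx z) <= growth w l z.
Proof.
move=> l0; rewrite ler_expR ler_wpM2l //.
apply: (weight_homo hw); first exact: enorm_ge0.
by rewrite ler_wsqrtr // dotv_split lerDr dotv_ge0.
Qed.

Lemma enormDpoly N : exists2 K, 0 <= K & forall xi : V,
  (1 + enorm xi) ^+ N <= K * growth w N%:R xi.
Proof.
have [K K1 HK] := enorm_le_growth d hw.
have K0 : 0 <= K by exact: le_trans ler01 K1.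
exists (K ^+ N) => [|xi]; first exact: exprn_ge0.
rewrite -[N%:R]mulr1 growthX -exprMn lerXn2r ?nnegrE ?mulr_ge0 ?growth_ge0 //.
by rewrite addr_ge0 ?enorm_ge0.
Qed.

(** Translation costs [growth w L] by the Peetre inequality; differentiating the modulation costs a
    polynomial of degree [N], absorbed by [growth w N]. *)
Lemma bnd_tfshift N L : 0 <= L -> exists A M, [/\ 0 < A, 0 <= M & forall z,
  bnd N (- L) (A * growth w M z) (tfshift z phi) /\
  bnd N (- L) (A * growth w M z) (fourier (tfshift z phi))].
Proof.
move=> L0; have [[sp rp] [sP rP]] := bphi.
have [B1 HB1] := rp N (- L); have [B2 HB2] := rP N (- L).
have B10 := bnd_ge0 HB1; have B20 := bnd_ge0 HB2.
have [K K0 HK] := enormDpoly N.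
pose B := B1 + B2 + 1.
have B0 : 0 < B by rewrite ltr_wpDl // addr_ge0.
pose A := 2 ^+ N * (K + 1) * B.
have A0 : 0 < A by rewrite !mulr_gt0 // ?exprn_gt0 // ltr_wpDl.
(* Serves both bounds: up to sign, [x] and [xi] are position and frequency for the window, and the
   reverse for its transform. *)
have key (x xi : V) z B' : growth w L x <= growth w L z -> 0 <= B' -> B' <= B ->
    growth w N%:R xi <= growth w N%:R z ->
    2 ^+ N * (1 + enorm xi) ^+ N * (growth w L x * B') <= A * growth w (N%:R + L) z.
  move=> xz B'0 B'B xiz.
  have -> : A * growth w (N%:R + L) z =
      2 ^+ N * ((K + 1) * growth w N%:R z) * (growth w L z * B).
    by rewrite growthM /A; ring.
  apply: ler_pM.
  - by rewrite mulr_ge0 ?exprn_ge0 // addr_ge0 ?enorm_ge0.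
  - by rewrite mulr_ge0 ?growth_ge0.
  - rewrite ler_wpM2l ?exprn_ge0 // (le_trans (HK xi)) //.
    by apply: ler_pM; rewrite ?growth_ge0 // lerDl.
  - by apply: ler_pM; rewrite ?growth_ge0.
exists A, (N%:R + L); split=> //; first by rewrite addr_ge0.
move=> z; split.
  rewrite tfshiftE.
  have := bndM hw (smooth_plane (rsubmx z)) (smooth_translate (- lsubmx z) sp)
    (@bnd_plane R d w N (rsubmx z)) (bnd_translate hw (- lsubmx z) L0 HB1).
  rewrite add0r; apply: bnd_le => //; apply: key => //.
  - by rewrite growth_even growth_lsubmx.
  - by rewrite /B -addrA lerDl addr_ge0.
  - by rewrite growth_rsubmx.
rewrite fourier_tfshift.
have spl := smooth_plane (- lsubmx z).
have H := bndM hw spl sP (@bnd_plane R d w N (- lsubmx z)) HB2; rewrite add0r in H.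
have := bnd_translate hw (- rsubmx z) L0 H; apply: bnd_le => //.
have := key (- rsubmx z) (- lsubmx z) z B2.
rewrite growth_even enormN !growth_even => K2.
rewrite mulrCA; apply: K2 => //.
- by rewrite growth_rsubmx.
- by rewrite /B addrAC lerDr addr_ge0.
- by rewrite growth_lsubmx.
Qed.

Lemma stft_growth u : tempered u -> exists A M, [/\ 0 <= A, 0 <= M & forall z,
  cmod (u (tfshift z phi)) <= A * growth w M z].
Proof.
move=> [_ [N [L [M [L0 M0 HM]]]]]; have [A [M' [A0 M'0 HA]]] := bnd_tfshift N L0.
exists (M * A), M'; split=> //; first by rewrite mulr_ge0 // ltW.
move=> z; have [H1 H2] := HA z; rewrite -mulrA; apply: HM => //.
  exact: birapid_tfshift.
by rewrite mulr_gt0 // growth_gt0.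
Qed.

Definition microregular z0 u := exists G : set 'rV[R]_(d + d),
  [/\ open G, conic G, ~ G 0, G z0 & forall l, 0 < l ->
    has_ubound [set growth w l z * cmod (stft phi u z) | z in G]].

(* [h] is chosen as a negative power of the weight at [z]. *)
Lemma microregular_quotient z0 u v (e : 'rV[R]_(d + d)) A M :
  tempered u -> enorm e <= 1 -> 0 <= A -> 0 <= M ->
  (forall z h, 0 < h -> h <= 1 -> h * cmod (stft phi v z) <=
    cmod (stft phi u (z + h *: e)) + cmod (stft phi u z) +
    A * h ^+ 2 * growth w M z) ->
  microregular z0 u -> microregular z0 v.
Proof.
move=> tu e1 A0 M0 HQ [G [oG cG G0 Gz0 HG]].
have [H [r [oH cH H0 Hz0 HH]]] := open_conic_shrink oG cG G0 Gz0.
exists H; split=> // l l0.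
have [A' [M' [A'0 M'0 HA']]] := stft_growth tu.
(* With [h = growth w (- k) z], division by [h] raises the rate asked of [u] from [l] to [q];
   [k = l + M] makes [growth q * h^2 * growth M] equal to 1. *)
pose k := l + M; pose q := l + k.
have k0 : 0 <= k by rewrite addr_ge0 // ltW.
have q0 : 0 < q by rewrite ltr_wpDr.
have [B HB] := HG q q0.
pose E m := expR (m * w 1).
have he z h : 0 < h -> h <= 1 -> enorm (h *: e) <= 1.
  move=> h0 h1; rewrite enormZ gtr0_norm // -[leRHS]mulr1.
  by apply: ler_pM; rewrite ?enorm_ge0 // ltW.
have near_le m z h : 0 <= m -> 0 < h -> h <= 1 ->
    growth w m (z + h *: e) <= growth w m z * E m.
  move=> m0 h0 h1; apply: (le_trans (growthD hw _ _ m0)).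
  by rewrite ler_wpM2l ?growth_ge0 // growth_ball // he.
have near_ge m z h : 0 <= m -> 0 < h -> h <= 1 ->
    growth w m z <= growth w m (z + h *: e) * E m.
  move=> m0 h0 h1; rewrite -[z in leLHS](addrK (h *: e)).
  apply: (le_trans (growthD hw _ _ m0)).
  by rewrite ler_wpM2l ?growth_ge0 // growth_ball // enormN he.
(* For |z| < r the point [z + h e] may leave [G]; there [h = 1] and the a priori growth of the
   transform of [u] are used. *)
pose near_bound := expR (l * w r) *
  (A' * (expR (M' * w r) * E M') + A' * expR (M' * w r) + A * expR (M * w r)).
exists (near_bound + (`|B| * E q + `|B| + A)).
have E0 m : 0 <= E m by exact: expR_ge0.
have far0 : 0 <= `|B| * E q + `|B| + A by rewrite !addr_ge0 // mulr_ge0.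
have nb0 : 0 <= near_bound.
  by rewrite mulr_ge0 ?expR_ge0 // !addr_ge0 // !mulr_ge0 ?expR_ge0.
move=> _ [z Hz <-].
have [rz|zr] := leP r (enorm z); last first.
  rewrite ler_wpDr //.
  have gr m : 0 <= m -> growth w m z <= expR (m * w r).
    move=> m0; rewrite ler_expR ler_wpM2l //.
    by apply: (weight_homo hw); [exact: enorm_ge0|exact: ltW].
  apply: ler_pM; rewrite ?growth_ge0 ?cmod_ge0 ?gr ?(ltW l0) //.
  have := HQ z 1 ltr01 (lexx 1); rewrite mul1r expr1n mulr1 => /le_trans; apply.
  apply: lerD; [apply: lerD|].
  - apply: (le_trans (HA' _)); rewrite ler_wpM2l //.
    apply: (le_trans (near_le _ _ _ M'0 ltr01 (lexx 1))).
    by rewrite ler_wpM2r // gr.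
  - by apply: (le_trans (HA' _)); rewrite ler_wpM2l // gr.
  - by rewrite ler_wpM2l // gr.
rewrite ler_wpDl //.
pose h := growth w (- k) z; have h0 : 0 < h by exact: growth_gt0.
have h1 : h <= 1 by rewrite -(growth0 w z); apply: ler_growth; rewrite // oppr_le0.
have GB y : G y -> growth w q y * cmod (stft phi u y) <= `|B|.
  by move=> Gy; apply: le_trans (ler_norm B); apply: HB; exists y.
have Gz : G z by rewrite -(addr0 z); apply: HH => //; rewrite enorm0.
have Gzh : G (z + h *: e) by apply: HH => //; exact: he.
have hk : growth w k z * h = 1 by rewrite /h growthN.
have -> : growth w l z * cmod (stft phi v z) =
    growth w q z * (h * cmod (stft phi v z)).
  by rewrite /q growthM mulrA -(mulrA (growth w l z)) hk mulr1.
apply: (le_trans (ler_wpM2l (growth_ge0 _ _ _) (HQ z h h0 h1))).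
rewrite !mulrDr; apply: lerD; [apply: lerD|].
(* The decay is known at [z + h e]; moving the weight from there to [z] costs the constant [E q]. *)
- apply: (le_trans (ler_wpM2r (cmod_ge0 _) (near_ge _ _ _ (ltW q0) h0 h1))).
  by rewrite mulrAC ler_wpM2r // GB.
- exact: GB.
rewrite le_eqVlt; apply/orP; left; apply/eqP.
have -> : growth w q z * (A * h ^+ 2 * growth w M z) =
    A * ((growth w k z * h) * ((growth w l z * growth w M z) * h)).
  by rewrite /q growthM; ring.
by rewrite -growthM -/k hk !mulr1.
Qed.

End Microlocal.

(** * Stability of microlocal regularity under the operators *)

Section MicrolocalClosure.
Variables (R : realType) (d : nat) (w : R -> R) (phi : 'rV[R]_d -> R[i]).
Hypothesis hw : weight w.
Hypothesis bphi : birapid w phi.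
Local Notation V := 'rV[R]_d.
Local Notation C := R[i].
Local Notation birapid := (@birapid R d w).
Local Notation tempered := (@tempered R d w).
Local Notation microregular := (microregular w phi).
Implicit Types (f g : V -> C) (s : seq 'I_d) (j : 'I_d) (a b : multi_index d).
Implicit Types (u v : (V -> C) -> C) (z : 'rV[R]_(d + d)).

(** Modulating [tfshift z phi] moves [z] by [h] in the frequency direction [j], with no extra
    phase. *)
Lemma microregular_coord z0 u j : tempered u -> microregular z0 u ->
  microregular z0 (fun f => u (fun y => coord j y * f y)).
Proof.
move=> tu; have [N [L [M [L0 M0 HM]]]] := modulation_quotient hw tu j.
have [A [M' [A0 M'0 HA]]] := bnd_tfshift hw bphi N L0.
pose e : 'rV[R]_(d + d) := row_mx 0 (delta_mx ord0 j).
have e1 : enorm e = 1.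
  rewrite /enorm dotv_split row_mxKl row_mxKr -!sqr_enorm enorm0 enorm_delta.
  by rewrite expr0n add0r expr1n sqrtr1.
apply: (@microregular_quotient _ _ _ _ hw bphi _ _ _ e (M * A) M') => //.
- by rewrite e1.
- by rewrite mulr_ge0 // ltW.
move=> z h h0 h1; have [b1 b2] := HA z.
have B0 : 0 < A * growth w M' z by rewrite mulr_gt0 // growth_gt0.
have := HM _ _ _ (birapid_tfshift hw bphi z) B0 h0 h1 b1 b2.
rewrite (_ : M * A * h ^+ 2 * _ = M * h ^+ 2 * (A * growth w M' z)); last by ring.
rewrite (_ : (fun y => plane _ y * tfshift z phi y) = tfshift (z + h *: e) phi) //.
have lE : lsubmx (z + h *: e) = lsubmx z.
  by rewrite linearD linearZ /= row_mxKl scaler0 addr0.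
have rE : rsubmx (z + h *: e) = rsubmx z + h *: delta_mx ord0 j.
  by rewrite linearD linearZ /= row_mxKr.
apply/funext => y; rewrite /tfshift lE rE.
by rewrite mulrA -cisD -dotvDr [h *: _ + _]addrC.
Qed.

(** Evaluating at [y + h e_j] moves the position part of [z] by [- h e_j], whence the sign in [e];
    the phase left over is unimodular and does not affect the modulus. *)
Lemma microregular_partial z0 u j : tempered u -> microregular z0 u ->
  microregular z0 (fun f => u (partial j f)).
Proof.
move=> tu; have [N [L [M [L0 M0 HM]]]] := translation_quotient hw tu j.
have [A [M' [A0 M'0 HA]]] := bnd_tfshift hw bphi N L0.
pose e : 'rV[R]_(d + d) := row_mx (- delta_mx ord0 j) 0.
have e1 : enorm e = 1.
  rewrite /enorm dotv_split row_mxKl row_mxKr -!sqr_enorm enorm0 enormN enorm_delta.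
  by rewrite expr0n addr0 expr1n sqrtr1.
apply: (@microregular_quotient _ _ _ _ hw bphi _ _ _ e (M * A) M') => //.
- by rewrite e1.
- by rewrite mulr_ge0 // ltW.
move=> z h h0 h1; have [b1 b2] := HA z.
have B0 : 0 < A * growth w M' z by rewrite mulr_gt0 // growth_gt0.
have := HM _ _ _ (birapid_tfshift hw bphi z) B0 h0 h1 b1 b2.
rewrite (_ : M * A * h ^+ 2 * _ = M * h ^+ 2 * (A * growth w M' z)); last by ring.
have -> : (fun y => tfshift z phi (y + h *: delta_mx ord0 j)) =
    fun y => cis (dotv (h *: delta_mx ord0 j) (rsubmx z)) *
      tfshift (z + h *: e) phi y.
  have lE : lsubmx (z + h *: e) = lsubmx z - h *: delta_mx ord0 j.
    by rewrite linearD linearZ /= row_mxKl scalerN.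
  have rE : rsubmx (z + h *: e) = rsubmx z.
    by rewrite linearD linearZ /= row_mxKr scaler0 addr0.
  apply/funext => y; rewrite /tfshift lE rE mulrA -cisD dotvDl addrC.
  by rewrite opprB addrA.
rewrite (temperedZ hw tu) ?cmodM ?cmod_conjc ?cmod_cis ?mul1r //.
exact: birapid_tfshift.
Qed.

(** The outermost derivative is absorbed into the functional, so the induction runs over all [u].
    Temperedness is carried along for the multiplications that follow. *)
Lemma microregular_partials z0 s u : tempered u -> microregular z0 u ->
  tempered (fun f => u (partials s f)) /\
  microregular z0 (fun f => u (partials s f)).
Proof.
elim: s u => // j s IH u tu mu.
exact: IH (tempered_partial hw tu j) (microregular_partial j tu mu).
Qed.

Definition coords s f := foldr (fun j g y => coord j y * g y) f s.

Lemma microregular_coords z0 s u : tempered u -> microregular z0 u ->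
  microregular z0 (fun f => u (coords s f)).
Proof.
elim: s u => // j s IH u tu mu.
exact: IH (tempered_coord hw tu j) (microregular_coord j tu mu).
Qed.

Lemma coordsE s f y : coords s f y = (\prod_(j <- s) coord j y) * f y.
Proof.
elim: s => [|j s IH]; first by rewrite big_nil mul1r.
by rewrite big_cons -mulrA -IH.
Qed.

Lemma birapid_coords s f : birapid f -> birapid (coords s f).
Proof. by move=> bf; elim: s => //= j s; exact: birapid_coord. Qed.

Lemma birapid_partials s f : birapid f -> birapid (partials s f).
Proof. by move=> bf; elim: s => //= j s; exact: birapid_partial. Qed.

Lemma mono_coords a f : (fun y => mono a y * f y) = coords (word a) f.
Proof.
apply/funext => y; rewrite coordsE; congr (_ * _).
rewrite /mono /word rmorph_prod big_flatten big_map big_enum /=.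
by apply: eq_bigr => j _; rewrite big_nseq iter_mulr_1 /coord rmorphXn.
Qed.

(** Agreement on S_w suffices, because the transform evaluates functionals only at shifts of the
    window. *)
Lemma microregular_ext z0 u v : (forall f, birapid f -> u f = v f) ->
  microregular z0 u -> microregular z0 v.
Proof.
move=> uv [G [oG cG G0 Gz0 HG]]; exists G; split=> // l l0.
have [B HB] := HG l l0; exists B => _ [z Gz <-].
rewrite /stft -uv; last exact: birapid_tfshift.
by apply: HB; exists z.
Qed.

Lemma microregularZ z0 (c : C) u : microregular z0 u ->
  microregular z0 (fun f => c * u f).
Proof.
move=> [G [oG cG G0 Gz0 HG]]; exists G; split=> // l l0.
have [B HB] := HG l l0; exists (cmod c * B) => _ [z Gz <-].
rewrite /stft cmodM mulrCA ler_wpM2l ?cmod_ge0 //.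
by apply: HB; exists z.
Qed.

Lemma microregular0 z0 : z0 != 0 -> microregular z0 (fun=> 0).
Proof.
move=> z00; exists [set z | z != 0]; split=> //.
- rewrite (_ : [set _ | _] = ~` [set 0]); last first.
    by apply/seteqP; split=> z /=; [move/eqP|move/eqP].
  apply: closed_openC; apply: accessible_closed_set1.
  by apply: hausdorff_accessible; exact: norm_hausdorff.
- by move=> t z t0 /= z1; rewrite scaler_eq0 negb_or gt_eqF.
- by rewrite /= eqxx.
by move=> l l0; exists 0 => _ [z _ <-]; rewrite /stft cmod0 mulr0.
Qed.

Lemma microregularD z0 u v : microregular z0 u -> microregular z0 v ->
  microregular z0 (fun f => u f + v f).
Proof.
move=> [G [oG cG G0 Gz0 HG]] [H [oH cH H0 Hz0 HH]].
exists (G `&` H); split=> //; first exact: openI.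
- by move=> t z t0 [Gz Hz]; split; [exact: cG|exact: cH].
- by case.
move=> l l0; have [B HB] := HG l l0; have [B' HB'] := HH l l0.
exists (B + B') => _ [z [Gz Hz] <-].
apply: (le_trans (ler_wpM2l (growth_ge0 _ _ _) (cmodD _ _))).
by rewrite mulrDr lerD //; [apply: HB|apply: HB']; exists z.
Qed.

Lemma microregular_sum z0 (I : Type) (r : seq I) (P : pred I)
    (F : I -> (V -> C) -> C) : z0 != 0 ->
  (forall i, microregular z0 (F i)) ->
  microregular z0 (fun f => \sum_(i <- r | P i) F i f).
Proof.
move=> z00 mF; elim: r => [|i r IH].
  by under eq_fun do rewrite big_nil; exact: microregular0.
under eq_fun do rewrite big_cons.
by case: (P i) => //; exact: microregularD.
Qed.

Lemma microregular_diffop z0 m (c : multi_index d -> multi_index d -> C) u :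
  z0 != 0 -> tempered u -> microregular z0 u -> microregular z0 (diffop m c u).
Proof.
move=> z00 tu mu; apply: microregular_sum => // p; apply: microregular_sum => // q.
set a := of_bounded p; set b := of_bounded q; apply: microregularZ.
(* The dual operators act on the test function in reverse order: it is multiplied by the monomial,
   then differentiated, so the derivatives are composed with [u] before the coordinates. The power
   of -i in [Dop] leaves the conjugate linear [u] conjugated. *)
have [tv mv] := microregular_partials (word b) tu mu.
apply: microregular_ext
  (microregularZ (conjc ((0 -i* 1) ^+ mlength b))
    (microregular_coords (word a) tv mv)).
move=> f bf; rewrite /dual_mono /dual_Dop mono_coords -(temperedZ hw tu) //.
by apply: birapid_partials; exact: birapid_coords.
Qed.

End MicrolocalClosure.

Theorem theorem4p12 (R : realType) (d : nat) (w : R -> R) (m : nat)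
  (c : multi_index d -> multi_index d -> R[i])
  (u : ('rV[R]_d -> R[i]) -> R[i]) (phi : 'rV[R]_d -> R[i]) :
  weight w -> (0 < m)%N -> Sw_dual w u ->
  Sw w phi -> phi <> (fun=> 0) ->
  gabor_wf w phi (diffop m c u) `<=` gabor_wf w phi u.
Proof.
move=> hw _ /(Sw_dual_tempered hw) tu /(birapid_Sw hw) bphi _ z0 [z00 nm].
split=> // mu; apply: nm.
exact: microregular_diffop.
Qed.
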